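(* Let $\mathbb{K}$ be a field. Let $\Delta_1$ and $\Delta_2$ be simplicial complexes (each containing the empty face) on disjoint finite ground sets $\Omega_1$ and $\Omega_2$, and let $\Delta$ be the simplicial complex on ground set $\Omega_1\cup\Omega_2$ given by $\Delta=(\Delta_1^\circ*\Delta_2^\circ)^\circ$. Then the multiplication on the singular cohomology ring $\operatorname{H}^*(M_\Delta;\mathbb{K})$ of the moment-angle complex $M_\Delta$ is trivial, i.e. the product of any two elements of positive degree is $0$.
   Context: A simplicial complex on a finite ground set $\Omega$ is a collection of subsets of $\Omega$ closed under taking subsets (not every element of $\Omega$ need be a vertex; Alexander duals and joins may be the void complex with no faces at all). The Alexander dual of a simplicial complex $\Delta$ on $\Omega$ is $\Delta^\circ=\{A\subseteq\Omega \mid \Omega\setminus A\notin\Delta\}$, again on ground set $\Omega$. The join of complexes $\Gamma_1,\Gamma_2$ on disjoint ground sets $\Omega_1,\Omega_2$ is $\Gamma_1*\Gamma_2=\{F_1\cup F_2\mid F_1\in\Gamma_1,\ F_2\in\Gamma_2\}$ on ground set $\Omega_1\cup\Omega_2$. For a simplicial complex $\Delta$ on ground set $[n]=\{1,\ldots,n\}$ (or any finite set identified with $[n]$), the moment-angle complex is $M_\Delta=\{(v_1,\ldots,v_n)\in(D^2)^n \mid \{i\mid v_i\notin S^1\}\in\Delta\}$, where $D^2=\{v\in\mathbb{R}^2\mid \|v\|\le 1\}$ is the unit disk and $S^1$ its bounding unit circle. *)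

(* Defs.v *)
From HB Require Import structures.
From mathcomp Require Import all_boot all_order all_algebra.
From mathcomp Require Import generic_quotient ring_quotient.
From mathcomp Require Import all_classical all_reals topology normedtype.
From mathcomp Require Import zify.

Set Implicit Arguments.
Unset Strict Implicit.
Unset Printing Implicit Defensive.

Import Order.TTheory GRing.Theory Num.Theory.
Import numFieldNormedType.Exports.

Local Open Scope ring_scope.

Section SimplicialComplexes.
Variable T : finType.
Implicit Types (W A F : {set T}) (D : {set {set T}}).
Local Open Scope set_scope.

(* D may be empty (the void complex), and elements of W need not be vertices. *)
Definition simplicial_complex W D : Prop :=
  (forall F, F \in D -> F \subset W) /\
  (forall F A, F \in D -> A \subset F -> A \in D).

Definition alexander_dual W D : {set {set T}} :=
  [set A : {set T} | (A \subset W) && (W :\: A \notin D)].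

Definition complex_join D1 D2 : {set {set T}} :=
  [set F1 :|: F2 | F1 : {set T} in D1, F2 : {set T} in D2].

End SimplicialComplexes.

Section MomentAngle.
Variables (R : realType) (T : finType) (W : {set T}) (D : {set {set T}}).
Local Open Scope classical_set_scope.

(* The Euclidean norm is written out: the library norm on R * R is the
   sup norm. *)
Definition unit_disk : set (R * R) := [set v | v.1 ^+ 2 + v.2 ^+ 2 <= 1].
Definition unit_circle : set (R * R) := [set v | v.1 ^+ 2 + v.2 ^+ 2 = 1].

Definition moment_angle_set : set {ptws {x : T | x \in W} -> (R * R)%type} :=
  [set v | (forall i, unit_disk (v i)) /\
    [set val i | i : {x : T | x \in W} & v i \notin unit_circle]%SET \in D].

Definition moment_angle_complex : topologicalType := set_type moment_angle_set.

End MomentAngle.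
Arguments moment_angle_set R [T] W D.
Arguments moment_angle_complex R [T] W D.

Definition std_simplex (R : realType) (n : nat) : set 'rV[R]_n.+1 :=
  [set t | (forall i, 0 <= t 0 i) /\ \sum_i t 0 i = 1]%classic.
Arguments std_simplex : clear implicits.

Section VertexMaps.
Variable R : realType.
Local Open Scope classical_set_scope.

(* The affine extension of a map of vertices. *)
Definition vertex_map_fun m n (f : 'I_m.+1 -> 'I_n.+1) (t : 'rV[R]_m.+1) :
  'rV[R]_n.+1 := \row_j \sum_(i | f i == j) t 0 i.

Lemma vertex_map_subproof m n (f : 'I_m.+1 -> 'I_n.+1) (t : std_simplex R m) :
  vertex_map_fun f (val t) \in std_simplex R n.
Proof.
have /set_mem [t0 t1] := valP t.
apply/mem_set; split=> [j|]; first by rewrite mxE sumr_ge0.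
rewrite -[RHS]t1 (partition_big f predT) //=.
by apply: eq_bigr => j _; rewrite mxE.
Qed.

Definition vertex_map m n (f : 'I_m.+1 -> 'I_n.+1) (t : std_simplex R m) :
  std_simplex R n :=
  exist (fun u => u \in std_simplex R n) _ (vertex_map_subproof f t).

Lemma continuous_real_sum (X : topologicalType) (I : Type) (r : seq I)
    (P : pred I) (F : I -> X -> R) :
  (forall i, continuous (F i)) ->
  continuous (fun x => \sum_(i <- r | P i) F i x).
Proof.
move=> cF x; elim: r => [|i r IH].
  under eq_fun do rewrite big_nil.
  exact: cvg_cst.
under eq_fun do rewrite big_cons.
by case: (P i) => //; apply: cvgD; [exact: cF | exact: IH].
Qed.

Lemma vertex_map_continuous m n (f : 'I_m.+1 -> 'I_n.+1) :
  continuous (vertex_map f).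
Proof.
apply: (@continuous_comp_initial (std_simplex R n) _ _ set_val).
move=> t M [P nP sPM]; have FF : Filter (nbhs t) by exact: nbhs_filter.
have PF i j : \forall u \near t, P i j (vertex_map_fun f (val u) i j).
  suff c : continuous (fun u : std_simplex R m => vertex_map_fun f (val u) i j).
    by apply: c; exact: nP.
  under eq_fun do rewrite mxE.
  apply: continuous_real_sum => k u.
  have cv : continuous (set_val : std_simplex R m -> 'rV[R]_m.+1).
    exact: initial_continuous.
  apply: (@continuous_comp _ _ _ set_val (fun M : 'rV[R]_m.+1 => M 0 k) u).
    exact: cv.
  exact: coord_continuous.
have {}PF := filter_forall FF (fun i => filter_forall FF (PF i)).
apply: (@filterS _ (nbhs t) FF _ _ _ PF) => u; exact: sPM.
Qed.

HB.instance Definition _ m n (f : 'I_m.+1 -> 'I_n.+1) :=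
  @isContinuous.Build _ _ (vertex_map f) (@vertex_map_continuous m n f).

Lemma vertex_map_comp l m n (g : 'I_m.+1 -> 'I_n.+1) (f : 'I_l.+1 -> 'I_m.+1) :
  vertex_map g \o vertex_map f = vertex_map (g \o f).
Proof.
apply/funext => t; apply/val_inj/rowP => k /=; rewrite !mxE.
rewrite (partition_big f (fun j => g j == k)) //=.
apply: eq_bigr => j /eqP gjk; rewrite mxE; apply: eq_bigl => i.
by case: eqP => [->|_]; rewrite ?gjk ?eqxx ?andbF.
Qed.

End VertexMaps.

Arguments vertex_map R [m n] f.

Section SingularCochains.
Variables (R : realType) (K : comNzRingType) (X : topologicalType).

Definition singular_simplex (n : nat) : Type :=
  continuousType (std_simplex R n) X.

Definition simplex_face m n (f : 'I_m.+1 -> 'I_n.+1) (s : singular_simplex n) :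
  singular_simplex m := s \o vertex_map R f.

Lemma simplex_face_comp l m n (g : 'I_m.+1 -> 'I_n.+1)
    (f : 'I_l.+1 -> 'I_m.+1) s :
  simplex_face f (simplex_face g s) = simplex_face (g \o f) s.
Proof. by apply/continuousEP => t /=; rewrite -vertex_map_comp. Qed.

Definition cochain (n : nat) : Type := singular_simplex n -> K.
HB.instance Definition _ n := GRing.Zmodule.on (cochain n).

Lemma cochain0E n (s : singular_simplex n) : (0 : cochain n) s = 0.
Proof. by []. Qed.

Lemma cochainBE n (a b : cochain n) s : (a - b) s = a s - b s.
Proof. by []. Qed.

(* lift i : 'I_n.+1 -> 'I_n.+2 is the increasing injection missing i. *)
Definition coboundary n (a : cochain n) : cochain n.+1 :=
  fun s => \sum_(i < n.+2) (-1) ^+ i * a (simplex_face (lift i) s).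

Lemma coboundary_is_zmod_morphism n : zmod_morphism (@coboundary n).
Proof.
move=> a b; apply/funext => s; rewrite /coboundary !fctE -sumrB.
by apply: eq_bigr => i _; rewrite mulrBr.
Qed.

HB.instance Definition _ n :=
  GRing.isZmodMorphism.Build (cochain n) (cochain n.+1) (@coboundary n)
    (@coboundary_is_zmod_morphism n).

(* The increasing inclusions of the first (resp. last) m.+1 of the vertices
   0, ..., n; they are meaningful for m <= n, where inord does not truncate. *)
Definition front m n (i : 'I_m.+1) : 'I_n.+1 := inord i.
Definition back m n (i : 'I_m.+1) : 'I_n.+1 := inord (n - m + i).

Definition cup_at n p q (a : cochain p) (b : cochain q) : cochain n :=
  fun s => a (simplex_face (@front p n) s) * b (simplex_face (@back q n) s).
Arguments cup_at n [p q] a b.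

Definition cup_cochain p q (a : cochain p) (b : cochain q) :
  cochain (p + q)%N :=
  cup_at (p + q)%N a b.

Lemma coboundary_cup n p q (a : cochain p) (b : cochain q) s : n = (p + q)%N ->
  coboundary (cup_at n a b) s =
  cup_at n.+1 (coboundary a) b s + (-1) ^+ p * cup_at n.+1 a (coboundary b) s.
Proof.
move=> npq.
have bumpE h k : bump h k = if (h <= k)%N then k.+1 else k.
  by rewrite /bump; case: leqP.
have inordE m (f : 'I_m.+1 -> K) :
    \sum_(i < m.+1) f i = \sum_(0 <= i < m.+1) f (inord i).
  by rewrite big_mkord; apply: eq_bigr => i _; rewrite inord_val.
pose A := a (simplex_face (@front p n.+1) s).
pose B := b (simplex_face (@back q n.+1) s).
rewrite /cup_at /coboundary !inordE -/A -/B.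
rewrite (@big_cat_nat _ _ _ p.+1) //=; last by lia.
rewrite (@big_nat_recr _ _ _ p.+1) //= mulrDl.
rewrite [\sum_(0 <= i < q.+2) _]big_nat_recl //=.
rewrite -!addrA; congr (_ + _).
  rewrite mulr_suml; apply: eq_big_nat => i /andP[_ ip].
  rewrite !inordK; try lia.
  rewrite !simplex_face_comp -mulrA.
  have -> : lift (inord i : 'I_n.+2) \o @front p n =
      @front p.+1 n.+1 \o lift (inord i : 'I_p.+2).
    apply/funext => j; apply/val_inj; have ltj := ltn_ord j.
    rewrite /= /front /= ?bumpE !inordK;
    by rewrite /= ?bumpE; repeat (case: ifP => ?); lia.
  have -> // : lift (inord i : 'I_n.+2) \o @back q n = @back q n.+1.
  apply/funext => j; apply/val_inj; have ltj := ltn_ord j.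
  rewrite /= /back /= ?bumpE !inordK;
    by rewrite /= ?bumpE; repeat (case: ifP => ?); lia.
have -> : simplex_face (lift (inord p.+1)) (simplex_face (@front p.+1 n.+1) s) =
    simplex_face (@front p n.+1) s.
  rewrite simplex_face_comp; congr (simplex_face _ s).
  apply/funext => j; apply/val_inj; have ltj := ltn_ord j.
  rewrite /= /front /= ?bumpE !inordK;
    by rewrite /= ?bumpE; repeat (case: ifP => ?); lia.
have -> : simplex_face (lift (inord 0)) (simplex_face (@back q.+1 n.+1) s) =
    simplex_face (@back q n.+1) s.
  rewrite simplex_face_comp; congr (simplex_face _ s).
  apply/funext => j; apply/val_inj; have ltj := ltn_ord j.
  rewrite /= /back /= ?bumpE !inordK;
    by rewrite /= ?bumpE; repeat (case: ifP => ?); lia.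
rewrite -/A -/B !inordK // mulrDr mulrDr expr0 mul1r addrA exprS mulN1r mulNr.
rewrite mulrA mulNr addNr add0r.
rewrite -{1}[p.+1]add1n big_addn (_ : n.+2 - p = q.+2)%N; last by lia.
rewrite big_add1 /= !mulr_sumr; apply: eq_big_nat => j /andP[_ jq].
rewrite !inordK; try lia.
rewrite !simplex_face_comp.
have -> : lift (inord (j.+1 + p) : 'I_n.+2) \o @front p n = @front p n.+1.
  apply/funext => k; apply/val_inj; have ltk := ltn_ord k.
  rewrite /= /front /= ?bumpE !inordK;
    by rewrite /= ?bumpE; repeat (case: ifP => ?); lia.
have -> : lift (inord (j.+1 + p) : 'I_n.+2) \o @back q n =
    @back q.+1 n.+1 \o lift (inord j.+1 : 'I_q.+2).
  apply/funext => k; apply/val_inj; have ltk := ltn_ord k.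
  rewrite /= /back /= ?bumpE !inordK;
    by rewrite /= ?bumpE; repeat (case: ifP => ?); lia.
by rewrite -/A addnC exprD -!mulrA; congr (_ * _); rewrite mulrCA.
Qed.

Definition cocycle_pred n : {pred cochain n} := fun a => coboundary a == 0.

Lemma cocycle_predP n (a : cochain n) :
  reflect (coboundary a = 0) (a \in @cocycle_pred n).
Proof. exact: eqP. Qed.

Lemma cocycle_zmod_closed n : zmod_closed (@cocycle_pred n).
Proof.
split=> [|a b]; first by apply/cocycle_predP; rewrite raddf0.
move=> /cocycle_predP a0 /cocycle_predP b0; apply/cocycle_predP.
by rewrite raddfB /= a0 b0 subrr.
Qed.
HB.instance Definition _ n :=
  GRing.isZmodClosed.Build (cochain n) (@cocycle_pred n)
    (@cocycle_zmod_closed n).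

Record cocycle n := Cocycle {
  cocycle_val :> cochain n;
  cocycleP : cocycle_val \in @cocycle_pred n
}.
HB.instance Definition _ n := [isSub for @cocycle_val n].
HB.instance Definition _ n := [Choice of cocycle n by <:].
HB.instance Definition _ n := [SubChoice_isSubZmodule of cocycle n by <:].

(* The cochain group in degree -1 is zero. *)
Definition is_coboundary n : cochain n -> Prop :=
  match n with
  | 0 => fun a => a = 0
  | m.+1 => fun a => exists b : cochain m, a = coboundary b
  end.

Definition coboundary_pred n : {pred cocycle n} :=
  fun z => `[< is_coboundary z >].

Lemma coboundary_predP n (z : cocycle n) :
  reflect (is_coboundary z) (z \in @coboundary_pred n).
Proof. exact: asboolP. Qed.

Lemma is_coboundary_zmod_closed n :
  is_coboundary (0 : cochain n) /\
  (forall a b : cochain n,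
     is_coboundary a -> is_coboundary b -> is_coboundary (a - b)).
Proof.
case: n => [|n] /=; first by split=> // a b -> ->; rewrite subrr.
split=> [|_ _ [c ->] [d ->]]; first by exists 0; rewrite raddf0.
by exists (c - d); rewrite raddfB.
Qed.

Lemma coboundary_zmod_closed n : zmod_closed (@coboundary_pred n).
Proof.
have [B0 BB] := is_coboundary_zmod_closed n.
split=> [|a b]; first exact/coboundary_predP.
move=> /coboundary_predP Ba /coboundary_predP Bb.
by apply/coboundary_predP; exact: BB.
Qed.
HB.instance Definition _ n := GRing.isZmodClosed.Build (cocycle n)
  (@coboundary_pred n) (@coboundary_zmod_closed n).

Definition cohomology n : zmodType := Quotient.quot (@coboundary_pred n).

Lemma cup_cocycle_subproof p q (a : cocycle p) (b : cocycle q) :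
  cup_cochain a b \in @cocycle_pred (p + q)%N.
Proof.
apply/cocycle_predP/funext => s; rewrite coboundary_cup //.
have /cocycle_predP a0 := cocycleP a; have /cocycle_predP b0 := cocycleP b.
by rewrite /cup_at a0 b0 !cochain0E mul0r !mulr0 addr0.
Qed.

Definition cup_cocycle p q (a : cocycle p) (b : cocycle q) :
  cocycle (p + q)%N :=
  Cocycle (cup_cocycle_subproof a b).

Lemma is_coboundary_cupl p q (a : cochain p) (b : cocycle q) :
  is_coboundary a -> is_coboundary (cup_cochain a b).
Proof.
have /cocycle_predP b0 := cocycleP b.
case: p a => [|p] a /= => [->|[c ->]].
  suff -> : cup_cochain (0 : cochain 0) b = 0.
    exact: (is_coboundary_zmod_closed _).1.
  by apply/funext => s; rewrite /cup_cochain /cup_at !cochain0E mul0r.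
exists (cup_cochain c b); apply/funext => s.
by rewrite coboundary_cup // b0 /cup_at !cochain0E !mulr0 addr0.
Qed.

Lemma is_coboundary_cupr p q (a : cocycle p) (b : cochain q) :
  is_coboundary b -> is_coboundary (cup_cochain a b).
Proof.
have /cocycle_predP a0 := cocycleP a.
case: q b => [|q] b /= => [->|[c ->]].
  suff -> : cup_cochain a (0 : cochain 0) = 0.
    exact: (is_coboundary_zmod_closed _).1.
  by apply/funext => s; rewrite /cup_cochain /cup_at !cochain0E mulr0.
rewrite /cup_cochain; move: (p + q.+1)%N (addnS p q) => _ ->.
exists ((fun s => (-1) ^+ p * cup_cochain a c s) : cochain (p + q)%N).
apply/funext => s.
transitivity ((-1) ^+ p * coboundary (cup_cochain a c) s); last first.
  by rewrite /coboundary mulr_sumr; apply: eq_bigr => i _; rewrite mulrCA.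
rewrite coboundary_cup // a0 /cup_at !cochain0E mul0r add0r.
by rewrite mulrA -expr2 sqrr_sign mul1r.
Qed.

Lemma cup_cochain_sub p q (a' a : cochain p) (b' b : cochain q) :
  cup_cochain a' b' - cup_cochain a b =
  cup_cochain (a' - a) b' - (- cup_cochain a (b' - b)).
Proof.
apply/funext => s; rewrite opprK.
have addE (c d : cochain (p + q)%N) : (c + d) s = c s + d s by [].
rewrite cochainBE addE /cup_cochain /cup_at !cochainBE.
by rewrite mulrBl mulrBr addrA subrK.
Qed.

(* Graded multiplication of the cohomology ring; by cup_pi below it does not
   depend on the representatives repr x and repr y. *)
Definition cup p q (x : cohomology p) (y : cohomology q) :
  cohomology (p + q)%N :=
  (\pi_(cohomology (p + q)%N) (cup_cocycle (repr x) (repr y)))%qT.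

Lemma cup_pi p q (a : cocycle p) (b : cocycle q) :
  (cup (\pi_(cohomology p) a) (\pi_(cohomology q) b) =
   \pi_(cohomology (p + q)%N) (cup_cocycle a b))%qT.
Proof.
rewrite /cup; set a' := repr _; set b' := repr _.
have Ba : is_coboundary (a' - a : cocycle p).
  by apply/coboundary_predP; rewrite Quotient.idealrBE reprK.
have Bb : is_coboundary (b' - b : cocycle q).
  by apply/coboundary_predP; rewrite Quotient.idealrBE reprK.
apply/eqP; rewrite -Quotient.idealrBE; apply/coboundary_predP.
have -> : (cup_cocycle a' b' - cup_cocycle a b : cocycle _) =
  cup_cochain a' b' - cup_cochain a b :> cochain _ by [].
rewrite cup_cochain_sub.
have [B0 BB] := is_coboundary_zmod_closed (p + q)%N.
apply: (BB); first exact: is_coboundary_cupl.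
by rewrite -sub0r; apply: (BB) => //; exact: is_coboundary_cupr.
Qed.

End SingularCochains.

Arguments cohomology R K X n : clear implicits.

(* Main.v *)
From HB Require Import structures.
Require Import Defs.
From mathcomp Require Import all_boot all_order all_algebra.
From mathcomp Require Import generic_quotient ring_quotient.
From mathcomp Require Import all_classical all_reals topology normedtype.
From mathcomp Require Import sequences realfun.
From mathcomp Require Import ring lra zify.

Set Implicit Arguments.
Unset Strict Implicit.
Unset Printing Implicit Defensive.

Import Order.TTheory GRing.Theory Num.Theory.
Import numFieldNormedType.Exports.

Local Open Scope ring_scope.

(** A face [F] belongs to the complex of the theorem exactly when
    [W1 :&: F] is in [D1] or [W2 :&: F] is in [D2]: the two Alexander duals
    turn the conjunction in the definition of a join into a disjunction. So the
    moment-angle complex is the union of M_1 x B^W2 and B^W1 x M_2, where M_i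
    is the moment-angle complex of [Di] and B the unit disk; it has the
    homotopy type of the join of M_1 and M_2. Each of the two pieces can be
    contracted inside the union. In the first one, the coordinates in [W2] are
    free and can be moved along segments to a point of the circle; the
    coordinates in [W1] are then free in turn, since no coordinate in [W2] is
    off the circle, and can be moved to that point as well. Both pieces have
    open neighbourhoods that can be pushed into them ([core_nbhs]): the
    coordinates at distance at least one half from the center are pushed
    radially to the circle ([core_nbhs_contractible]).

    It remains to see that cup products of positive degree classes vanish on a
    space covered by two open sets [U] and [V] that are contractible in it
    ([cup_two_contractible]). By homotopy invariance the first class has a
    representing cocycle that vanishes on the simplices in [U], and the second
    one has a representing cocycle that vanishes on the simplices in [V]
    ([cohomology_rep]). Their cup product vanishes on every simplex contained
    in [U] or in [V], and a cocycle with this property is a coboundary by the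
    theorem of small simplices ([small_cocycle_coboundary]).

    The two tools from singular cohomology, the prism operator and barycentric
    subdivision, are defined by recursion on functions of a list of vertices.
    There the boundary of a cone [b :: w] over [w] has a closed form, and all
    chain homotopy identities reduce to it ([list_homotopy],
    [list_prism_homotopy]). A singular simplex, or a singular simplex times an
    interval, transports them to singular cochains through the simplices that
    are affine in it ([pull]). *)

(** * Cochains on lists of vertices *)

Section ListCochains.
Variables (P : eqType) (V : zmodType).
Implicit Types (phi psi : seq P -> V) (w u : seq P) (b x : P) (k : nat).

Definition cone b phi : seq P -> V := fun w => phi (b :: w).

(** This recursive form of the alternating sum over the faces of a list makes
    the identity of [cone_list_delta], on which everything below rests, true by
    computation. The empty list counts as a simplex of dimension [-1], so that
    this identity has no exception in dimension [0]. *)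
Fixpoint list_delta phi w : V :=
  if w is b :: w' then phi w' - list_delta (cone b phi) w' else 0.

Lemma cone_list_delta b phi :
  cone b (list_delta phi) = phi - list_delta (cone b phi).
Proof. by apply/funext. Qed.

Lemma eq_list_delta phi psi w :
  (forall u, subseq u w -> (size u).+1 = size w -> phi u = psi u) ->
  list_delta phi w = list_delta psi w.
Proof.
elim: w phi psi => [//|b w IH] phi psi eqp.
have epsi : phi w = psi w by apply: eqp => //; exact: subseq_cons.
rewrite /= epsi; congr (_ - _); apply: IH => u uw su.
by apply: eqp; rewrite /= ?eqxx ?su.
Qed.

Lemma list_deltaB phi psi :
  list_delta (phi - psi) = list_delta phi - list_delta psi.
Proof.
apply/funext => w; rewrite !fctE; elim: w phi psi => [|b w IH] phi psi /=.
  by rewrite subrr.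
by rewrite (IH (cone b phi) (cone b psi)) !opprD addrACA.
Qed.

Lemma list_delta0 w : list_delta 0 w = 0.
Proof. by rewrite -(subrr (0 : seq P -> V)) list_deltaB !fctE subrr. Qed.

Lemma list_delta_delta phi w : list_delta (list_delta phi) w = 0.
Proof.
elim: w phi => //= b w IH phi.
by rewrite cone_list_delta list_deltaB !fctE IH subr0 subrr.
Qed.

End ListCochains.

(** * Barycentric subdivision of list cochains *)

Section Subdivision.
Variables (P : eqType) (V : zmodType) (bary : seq P -> P).
Implicit Types (phi psi : seq P -> V) (w u : seq P) (k : nat).

(** Dual to the recursion sd(w) = b(w) . sd(dw) on chains, where [b w] is the
    barycenter of [w]. The number [k] of vertices of [w] is an argument because
    the recursion is not structural in [w]. *)
Fixpoint list_sd k phi w : V :=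
  if k is k'.+1 then list_delta (list_sd k' (cone (bary w) phi)) w else phi w.

(** Dual to the recursion T(w) = b(w) . (w - T(dw)) on chains. *)
Fixpoint list_hom k phi w : V :=
  if k is k'.+1 then
    cone (bary w) phi w - list_delta (list_hom k' (cone (bary w) phi)) w
  else 0.

Lemma eq_list_sd k phi psi w : size w = k ->
  (forall u, size u = k -> phi u = psi u) -> list_sd k phi w = list_sd k psi w.
Proof.
elim: k phi psi w => [|k IH] phi psi w sw e /=; first exact: e.
apply: eq_list_delta => u _; rewrite sw => -[su].
by apply: IH => // v sv; apply: e; rewrite /= sv.
Qed.

Lemma eq_list_hom k phi psi w : size w = k ->
  (forall u, size u = k.+1 -> phi u = psi u) ->
  list_hom k phi w = list_hom k psi w.
Proof.
elim: k phi psi w => [//|k IH] phi psi w sw e /=.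
rewrite /cone e /= ?sw //; congr (_ - _).
apply: eq_list_delta => u _; rewrite sw => -[su].
by apply: IH => // v sv; apply: e; rewrite /= sv.
Qed.

Lemma list_sdB k phi psi :
  list_sd k (phi - psi) = list_sd k phi - list_sd k psi.
Proof.
elim: k phi psi => [//|k IH] phi psi; apply/funext => w; rewrite !fctE /=.
by rewrite (IH (cone _ phi) (cone _ psi)) list_deltaB.
Qed.

Lemma list_homB k phi psi :
  list_hom k (phi - psi) = list_hom k phi - list_hom k psi.
Proof.
elim: k phi psi => [|k IH] phi psi; apply/funext => w; rewrite !fctE /=.
  by rewrite subrr.
rewrite (IH (cone _ phi) (cone _ psi)) list_deltaB /cone !fctE.
by rewrite !opprD addrACA.
Qed.

(** Subdivision is a chain map: the boundary of b . sd(dw) is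
    sd(dw) - b . d(sd(dw)), and the last term is b . sd(ddw) = 0 by
    induction. *)
Lemma list_sd_delta k phi w : size w = k.+1 ->
  list_sd k.+1 (list_delta phi) w = list_delta (list_sd k phi) w.
Proof.
elim: k phi w => [|k IH] phi w sw /=.
  rewrite cone_list_delta list_deltaB !fctE list_delta_delta subr0.
  exact: eq_list_delta.
rewrite cone_list_delta -[list_delta _]/(list_delta (list_sd k.+1 _)).
rewrite list_sdB list_deltaB !fctE; set psi := cone _ _.
rewrite [X in _ - X](_ : _ = 0) ?subr0 //.
rewrite -[RHS](list_delta_delta (list_sd k psi) w).
by apply: eq_list_delta => u _; rewrite sw => -[su]; exact: IH.
Qed.

(** By the cone formula, the boundary of T(w) = b . (w - T(dw)) is
    w - T(dw) - b . d(w - T(dw)), and by induction d(w - T(dw)) = sd(dw). *)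
Lemma list_homotopy k phi w : size w = k ->
  list_hom k (list_delta phi) w + list_delta (list_hom k.-1 phi) w =
  phi w - list_sd k phi w.
Proof.
elim: k phi w => [|k IH] phi w sw /=.
  by rewrite (size0nil sw) /= addr0 subrr.
rewrite cone_list_delta; set psi := cone _ _.
rewrite list_homB list_deltaB !fctE.
have -> : list_delta (list_hom k (list_delta psi)) w =
          list_delta psi w - list_delta (list_sd k psi) w.
  rewrite -[RHS]/((list_delta psi - list_delta (list_sd k psi)) w) -list_deltaB.
  rewrite -[RHS]subr0 -(list_delta_delta (list_hom k.-1 psi) w).
  rewrite -[RHS]/((list_delta (psi - list_sd k psi) - list_delta _) w).
  rewrite -list_deltaB; apply: eq_list_delta => u _; rewrite sw => -[su].
  by rewrite !fctE -(IH psi u su) addrK.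
by rewrite opprB opprD opprB addrA addrAC subrK addrA subrK.
Qed.

End Subdivision.

Section Naturality.
Variables (P Q : eqType) (V : zmodType) (f : P -> Q).
Variables (baryP : seq P -> P) (baryQ : seq Q -> Q).
Hypothesis f_bary : forall w, (0 < size w)%N ->
  baryQ (map f w) = f (baryP w).
Implicit Types (phi : seq Q -> V) (w : seq P).

Lemma list_delta_map phi w :
  list_delta (phi \o map f) w = list_delta phi (map f w).
Proof. by elim: w phi => //= x w IH phi; rewrite -IH. Qed.

Lemma list_sd_map k phi w : size w = k ->
  list_sd baryP k (phi \o map f) w = list_sd baryQ k phi (map f w).
Proof.
elim: k phi w => [//|k IH] phi w sw /=; rewrite f_bary ?sw // -list_delta_map.
apply: eq_list_delta => u _; rewrite sw => -[su].
exact: IH (cone (f (baryP w)) phi) u su.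
Qed.

Lemma list_hom_map k phi w : size w = k ->
  list_hom baryP k (phi \o map f) w = list_hom baryQ k phi (map f w).
Proof.
elim: k phi w => [//|k IH] phi w sw /=; rewrite f_bary ?sw // -list_delta_map.
congr (_ - _); apply: eq_list_delta => u _; rewrite sw => -[su].
exact: IH (cone (f (baryP w)) phi) u su.
Qed.

End Naturality.

(** * The prism operator on list cochains *)

Section Prism.
Variables (P Q : eqType) (V : comPzRingType) (bot top : P -> Q).
Implicit Types (phi psi : seq Q -> V) (w : seq P).

(** Dual to the signed sum of the simplices spanned by
    [bot x0, ..., bot xi, top xi, ..., top xn], which triangulate a prism. *)
Fixpoint list_prism phi w : V :=
  if w is x :: w' then
    phi (bot x :: map top w) - list_prism (cone (bot x) phi) w'
  else 0.

Lemma list_prismB phi psi :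
  list_prism (phi - psi) = list_prism phi - list_prism psi.
Proof.
apply/funext => w; rewrite !fctE; elim: w phi psi => [|x w IH] phi psi /=.
  by rewrite subrr.
by rewrite (IH (cone _ phi) (cone _ psi)) !opprD addrACA.
Qed.

(** Split off the first simplex of the prism: by the cone formula, what remains
    is the identity for the prism over [w], coned from [bot x]. *)
Lemma list_prism_homotopy phi w :
  list_prism (list_delta phi) w + list_delta (list_prism phi) w =
  phi (map top w) - phi (map bot w).
Proof.
elim: w phi => [|x w IH] phi /=; first by rewrite addr0 subrr.
set c := cone (bot x) phi; set psi := cone (top x) c.
have -> : cone x (list_prism phi) = (psi \o map top) - list_prism c by [].
rewrite cone_list_delta list_prismB list_deltaB.
rewrite -[X in _ + (_ - X)]/(list_delta (psi \o map top) w - _ w).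
rewrite list_delta_map !fctE /= -/c.
have /(canRL (addrK _)) -> := IH c.
rewrite /c /cone; ring.
Qed.

End Prism.

(** * Affine simplices in a standard simplex *)

Section Affine.
Variable R : realType.
Local Open Scope classical_set_scope.

Definition aff (V : lmodType R) m (g : 'I_m.+1 -> V) (t : std_simplex R m) : V :=
  \sum_i val t 0 i *: g i.

Lemma std_simplex_ge0 m (t : std_simplex R m) i : 0 <= val t 0 i.
Proof. by have /set_mem[t0 _] := valP t. Qed.

Lemma std_simplex_sum1 m (t : std_simplex R m) : \sum_i val t 0 i = 1.
Proof. by have /set_mem[_ t1] := valP t. Qed.

Lemma aff_cst (V : lmodType R) m (v : V) t : aff (fun _ : 'I_m.+1 => v) t = v.
Proof. by rewrite /aff -scaler_suml std_simplex_sum1 scale1r. Qed.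

Lemma aff_vertex_map (V : lmodType R) m n (f : 'I_m.+1 -> 'I_n.+1)
    (g : 'I_n.+1 -> V) t :
  aff g (vertex_map R f t) = aff (g \o f) t.
Proof.
rewrite /aff [RHS](partition_big f predT) //=; apply: eq_bigr => j _.
by rewrite mxE scaler_suml; apply: eq_bigr => i /eqP <-.
Qed.

(** Balls are convex. *)
Lemma aff_dist (V : normedModType R) m (g : 'I_m.+1 -> V) t y r :
  (forall i, `|g i - y| <= r) -> `|aff g t - y| <= r.
Proof.
move=> gr; rewrite -{1}[y](@aff_cst _ m y t) /aff -sumrB.
rewrite -[r]mul1r -(std_simplex_sum1 t) mulr_suml.
apply: le_trans (ler_norm_sum _ _ _) _; apply: ler_sum => i _.
rewrite -scalerBr normrZ ger0_norm ?std_simplex_ge0 //.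
by rewrite ler_wpM2l ?std_simplex_ge0.
Qed.

Lemma continuous_addr (X : topologicalType) (f g : X -> R) :
  continuous f -> continuous g -> continuous (fun x => f x + g x).
Proof. by move=> cf cg x; apply: cvgD; [exact: cf | exact: cg]. Qed.

Lemma continuous_mulr (X : topologicalType) (f g : X -> R) :
  continuous f -> continuous g -> continuous (fun x => f x * g x).
Proof. by move=> cf cg x; apply: cvgM; [exact: cf | exact: cg]. Qed.

Lemma set_val_coord_continuous n i :
  continuous (fun t : std_simplex R n => val t 0 i).
Proof.
move=> t; apply: (@continuous_comp _ _ _ set_val (fun M : 'rV[R]_n.+1 => M 0 i)).
  exact: initial_continuous.
exact: coord_continuous.
Qed.

Lemma aff_continuous m (g : 'I_m.+1 -> R^o) : continuous (aff g).
Proof.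
have -> : aff g = fun t => \sum_i (val t 0 i * g i : R) by [].
apply: continuous_real_sum => i; apply: continuous_mulr.
  exact: set_val_coord_continuous.
exact: cst_continuous.
Qed.

Lemma hull_subproof m n (g : 'I_m.+1 -> std_simplex R n) (t : std_simplex R m) :
  aff (val \o g) t \in std_simplex R n.
Proof.
apply/mem_set; split=> [j|].
  rewrite summxE sumr_ge0 // => i _.
  by rewrite mxE mulr_ge0 // std_simplex_ge0.
under eq_bigr do rewrite summxE.
rewrite exchange_big -[RHS](std_simplex_sum1 t); apply: eq_bigr => i _ /=.
by under eq_bigr do rewrite mxE; rewrite -mulr_sumr std_simplex_sum1 mulr1.
Qed.

Definition hull m n (g : 'I_m.+1 -> std_simplex R n) (t : std_simplex R m) :
    std_simplex R n :=
  exist (fun u => u \in std_simplex R n) _ (hull_subproof g t).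

Lemma to_std_simplex_continuous (X : topologicalType) n (h : X -> std_simplex R n) :
  (forall j, continuous (fun x => val (h x) 0 j)) -> continuous h.
Proof.
move=> hc; apply: (@continuous_comp_initial (std_simplex R n) _ _ set_val).
move=> x M [Q nQ sQM]; have FF : Filter (nbhs x) by exact: nbhs_filter.
have near_coord i j : \forall u \near x, Q i j (val (h u) i j).
  by rewrite (ord1 i); apply: hc; rewrite -(ord1 i); exact: nQ.
have near_all := filter_forall FF (fun i => filter_forall FF (near_coord i)).
by apply: (@filterS _ (nbhs x) FF _ _ _ near_all) => u; exact: sQM.
Qed.

Lemma hull_continuous m n (g : 'I_m.+1 -> std_simplex R n) : continuous (hull g).
Proof.
apply: to_std_simplex_continuous => j.
rewrite [X in continuous X](_ : _ =
    fun t : std_simplex R m => \sum_i val t 0 i * val (g i) 0 j).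
  apply: continuous_real_sum => i; apply: continuous_mulr.
    exact: set_val_coord_continuous.
  exact: cst_continuous.
by apply/funext => t; rewrite summxE; apply: eq_bigr => i _; rewrite mxE.
Qed.

HB.instance Definition _ m n (g : 'I_m.+1 -> std_simplex R n) :=
  @isContinuous.Build _ _ (hull g) (@hull_continuous m n g).

Lemma hull_vertex_map l m n (f : 'I_l.+1 -> 'I_m.+1)
    (g : 'I_m.+1 -> std_simplex R n) :
  hull g \o vertex_map R f = hull (g \o f).
Proof. by apply/funext => t; apply/val_inj; exact: aff_vertex_map. Qed.

(** Affine maps preserve affine combinations; this makes all constructions
    below natural with respect to affine simplices. *)
Lemma hull_hull l m n (h : 'I_l.+1 -> std_simplex R m)
    (g : 'I_m.+1 -> std_simplex R n) :
  hull g \o hull h = hull (hull g \o h).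
Proof.
apply/funext => t; apply/val_inj; rewrite /= /aff /=.
under eq_bigr do rewrite summxE scaler_suml.
rewrite exchange_big; apply: eq_bigr => i _; rewrite scaler_sumr.
by apply: eq_bigr => j _; rewrite mxE scalerA.
Qed.

Lemma vertex_subproof n (i : 'I_n.+1) : delta_mx 0 i \in std_simplex R n.
Proof.
apply/mem_set; split=> [j|]; first by rewrite mxE ler0n.
rewrite (bigD1 i) //= mxE !eqxx big1 ?addr0 // => j /negPf ji.
by rewrite mxE ji andbF.
Qed.

Definition vertex n (i : 'I_n.+1) : std_simplex R n :=
  exist (fun u => u \in std_simplex R n) _ (vertex_subproof i).

Lemma hull_vertex n : hull (@vertex n) = id.
Proof.
apply/funext => t; apply/val_inj/rowP => j; rewrite /= /aff.
by rewrite [in RHS](row_sum_delta (val t)).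
Qed.

Lemma hull_vertexE m n (g : 'I_m.+1 -> std_simplex R n) i : hull g (vertex i) = g i.
Proof.
apply/val_inj; rewrite /= /aff (bigD1 i) //= mxE !eqxx scale1r big1 ?addr0 //.
by move=> j /negPf ji; rewrite mxE ji andbF scale0r.
Qed.

Lemma centroid_subproof n : (const_mx n.+1%:R^-1 : 'rV_n.+1) \in std_simplex R n.
Proof.
apply/mem_set; split=> [j|]; first by rewrite mxE invr_ge0.
under eq_bigr do rewrite mxE.
by rewrite sumr_const card_ord -[_ *+ _]mulr_natr mulVf ?pnatr_eq0.
Qed.

Definition centroid n : std_simplex R n :=
  exist (fun u => u \in std_simplex R n) _ (centroid_subproof n).

End Affine.
Arguments vertex R {n} i.
Arguments centroid R n.

(** * From lists of vertices to singular simplices *)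

Section VertexLists.
Variable P : eqType.

Definition vertex_list n (g : 'I_n -> P) : seq P := map g (enum 'I_n).

Lemma size_vertex_list n (g : 'I_n -> P) : size (vertex_list g) = n.
Proof. by rewrite size_map size_enum_ord. Qed.

Lemma vertex_list_cons n (g : 'I_n.+1 -> P) :
  vertex_list g = g ord0 :: vertex_list (g \o lift ord0).
Proof. by rewrite /vertex_list enum_ordSl /= -map_comp. Qed.

Lemma vertex_list_surj n w : size w = n ->
  exists g : 'I_n -> P, w = vertex_list g.
Proof.
move=> /eqP sw; exists (tnth (Tuple sw)).
exact: esym (map_tnth_enum (Tuple sw)).
Qed.

Lemma list_delta_vertex_list (V : pzRingType) n (phi : seq P -> V)
    (g : 'I_n -> P) :
  list_delta phi (vertex_list g) =
  \sum_(i < n) (-1) ^+ i * phi (vertex_list (g \o lift i)).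
Proof.
elim: n phi g => [|n IH] phi g.
  by rewrite big_ord0 (size0nil (size_vertex_list g)).
rewrite vertex_list_cons /= IH big_ord_recl mul1r; congr (_ + _).
rewrite -sumrN; apply: eq_bigr => -[i ltin] _.
case: n IH g ltin => // n IH g ltin.
rewrite /= -[bump 0 i]/i.+1 exprS mulN1r mulNr /cone; congr (- (_ * phi _)).
rewrite [RHS]vertex_list_cons; congr (_ :: @vertex_list n _).
  by rewrite /=; congr g; apply/val_inj.
apply/funext => j /=; congr g; apply/val_inj.
by rewrite /= -[bump 0 i]/i.+1 -[bump 0 j]/j.+1 bumpS.
Qed.

End VertexLists.

Lemma vertex_list_map (P Q : eqType) (f : P -> Q) n (g : 'I_n -> P) :
  vertex_list (f \o g) = map f (vertex_list g).
Proof. exact: map_comp. Qed.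

Section Pull.
Variables (R : realType) (K : comNzRingType) (X : topologicalType).
Variables (P : eqType).
Variable A : forall m, ('I_m.+1 -> P) -> singular_simplex R X m.
Hypothesis A_face : forall m (g : 'I_m.+2 -> P) (i : 'I_m.+2),
  simplex_face (lift i) (A g) = A (g \o lift i).

(** [A] reads a tuple of elements of [P] as the vertices of a singular simplex
    of [X]. The value [0] on lists of the wrong length lets the operators on
    list cochains ignore degrees. *)
Definition pull n (c : cochain R K X n) (w : seq P) : K :=
  if insub w is Some t then c (A (tnth (t : n.+1.-tuple P))) else 0.

Lemma pull_vertex_list n (c : cochain R K X n) (g : 'I_n.+1 -> P) :
  pull c (vertex_list g) = c (A g).
Proof.
rewrite /pull -[vertex_list g]/(val [tuple g i | i < n.+1]) valK.
by congr (c (A _)); apply/funext => i; rewrite tnth_mktuple.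
Qed.

Lemma pull0 n w : pull (0 : cochain R K X n) w = 0.
Proof. by rewrite /pull; case: insub. Qed.

Lemma list_delta_pull n (c : cochain R K X n) w : size w = n.+2 ->
  list_delta (pull c) w = pull (coboundary c) w.
Proof.
case/vertex_list_surj => g ->; rewrite list_delta_vertex_list pull_vertex_list.
by apply: eq_bigr => i _; rewrite pull_vertex_list A_face.
Qed.

End Pull.

(** * Barycentric subdivision of singular cochains *)

Section Barycenter.
Variable R : realType.

(** The default value of [nth] is reached only for the empty list, of which
    the barycenter is arbitrary. *)
Definition bary n (w : seq (std_simplex R n)) : std_simplex R n :=
  hull (fun i : 'I_(size w).-1.+1 => nth (vertex R ord0) w i)
    (centroid R (size w).-1).

Lemma hull_bary m n (g : 'I_m.+1 -> std_simplex R n) (w : seq (std_simplex R m)) :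
  (0 < size w)%N -> bary (map (hull g) w) = hull g (bary w).
Proof.
move=> w0; rewrite /bary size_map -[RHS]/((hull g \o hull _) _) hull_hull.
congr (hull _ _); apply/funext => i /=.
by rewrite (nth_map (vertex R ord0)) // -[X in (_ < X)%N](prednK w0).
Qed.

Definition close_points n d (w : seq (std_simplex R n)) : Prop :=
  forall x y, x \in w -> y \in w -> `|val x - val y| <= d.

(** The average of [k] points includes, for each of them, one zero distance;
    this is why subdivision contracts by the factor [1 - 1/k]. *)
Lemma bary_dist n d (w : seq (std_simplex R n)) x k :
  close_points d w -> x \in w -> (size w <= k)%N ->
  `|val (bary w) - val x| <= (1 - k%:R^-1) * d.
Proof.
move=> cw xw wk; have w0 : (0 < size w)%N by case: (w) xw.
have dge0 : 0 <= d by apply: le_trans (cw _ _ xw xw); exact: normr_ge0.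
apply: (@le_trans _ _ ((1 - (size w)%:R^-1) * d)); last first.
  by rewrite ler_wpM2r // lerD2l lerN2 lef_pV2 ?posrE ?ltr0n ?ler_nat //; lia.
rewrite -{1}[val x](@aff_cst _ _ (size w).-1 (val x) (centroid R _)) /= /aff.
rewrite -sumrB; under eq_bigr do rewrite mxE -scalerBr.
rewrite -scaler_sumr normrZ ger0_norm ?invr_ge0 //.
rewrite [X in X%:R^-1](prednK w0).
pose j := index x w.
have ltj : (j < (size w).-1.+1)%N by rewrite prednK // index_mem.
rewrite (bigD1 (Ordinal ltj)) //= nth_index // subrr add0r.
rewrite mulrBl mul1r -[X in X - _](mulKf (_ : (size w)%:R != 0)); last first.
  by rewrite pnatr_eq0; lia.
rewrite -mulrBr ler_wpM2l ?invr_ge0 //.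
apply: le_trans (ler_norm_sum _ _ _) _.
apply: (@le_trans _ _ (\sum_(i < (size w).-1.+1 | i != Ordinal ltj) d)).
  apply: ler_sum => i _; apply: cw => //; apply: mem_nth.
  by rewrite -[X in (_ < X)%N](prednK w0).
rewrite sumr_const cardC1 card_ord /= -[_ *+ _]mulr_natl -[X in _ - X]mul1r.
by rewrite -mulrBl -{2}(prednK w0) -natr1 addrK.
Qed.

(** The intersection of the balls containing [w] replaces its convex hull: it
    contains the barycenters of [w] and of its sublists, and a point close to
    all of [w] is close to all of it. *)
Definition in_ball_hull n (w : seq (std_simplex R n)) (x : std_simplex R n) : Prop :=
  forall y r, (forall z, z \in w -> `|val z - y| <= r) -> `|val x - y| <= r.

Lemma bary_in_ball_hull n (w : seq (std_simplex R n)) :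
  (0 < size w)%N -> in_ball_hull w (bary w).
Proof.
move=> w0 y r wr; apply: aff_dist => i; apply: wr; apply: mem_nth.
by rewrite -[X in (_ < X)%N](prednK w0).
Qed.

(** A simplex of the subdivision of [w] consists of the barycenter of [w] and
    of vertices of the subdivision of a face. The latter are in the ball hull
    of [w], so the barycenter is as close to them as it is to [w]; the mutual
    distances of the latter are bounded by induction. *)
Lemma list_sd_close (V : zmodType) n d r k (phi : seq (std_simplex R n) -> V) w :
  size w = k -> (0 <= d) ->
  close_points d w ->
  (forall u, size u = k -> close_points ((1 - r%:R^-1) * d) u ->
     (forall x, x \in u -> in_ball_hull w x) -> phi u = 0) ->
  (k <= r)%N -> list_sd (@bary n) k phi w = 0.
Proof.
move=> sw d0; elim: k phi w sw => [|k IH] phi w sw cw phi0 kr /=.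
  by apply: phi0 => // x; rewrite (size0nil sw).
rewrite -[RHS](list_delta0 V w); apply: eq_list_delta => u uw; rewrite sw => -[su].
have sub := mem_subseq uw.
apply: (IH (cone (bary w) phi) u su _ _ (ltnW kr)).
  by move=> x y xu yu; apply: cw; apply: sub.
move=> v sv cv vhull; rewrite /cone; apply: phi0; first by rewrite /= sv.
  have v_bary x : x \in v -> `|val x - val (bary w)| <= (1 - r%:R^-1) * d.
    move=> /vhull; apply=> z zu; rewrite distrC.
    by apply: bary_dist (cw) (sub _ zu) _; rewrite sw.
  move=> x y; rewrite !inE => /orP[/eqP->|xv] /orP[/eqP->|yv].
  - rewrite subrr normr0 mulr_ge0 // subr_ge0 invf_le1 ?ler1n ?ltr0n //.
      by apply: leq_ltn_trans kr.
    by apply: leq_ltn_trans kr.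
  - by rewrite distrC; exact: v_bary.
  - exact: v_bary.
  - exact: cv.
move=> x; rewrite inE => /orP[/eqP->|/vhull xhull].
  by apply: bary_in_ball_hull; rewrite sw.
by move=> y s ws; apply: xhull => z /sub; exact: ws.
Qed.

Lemma iter_list_sd_close (V : zmodType) n k (phi : seq (std_simplex R n) -> V) e :
  (forall u, size u = k -> close_points e u -> phi u = 0) ->
  forall i d w, 0 <= d -> size w = k -> close_points d w ->
    (1 - k%:R^-1) ^+ i * d <= e -> iter i (list_sd (@bary n) k) phi w = 0.
Proof.
move=> phi0; elim=> [|i IH] d w d0 sw cw.
  rewrite expr0 mul1r => de; apply: phi0 => // x y xw yw.
  by apply: le_trans de; exact: cw.
rewrite exprSr -mulrA iterS => le_e.
apply: (list_sd_close sw d0 cw _ (leqnn k)) => u su cu _.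
apply: (IH _ u _ su cu le_e); rewrite mulr_ge0 // subr_ge0.
by case: (k) => [|m]; rewrite ?invr0 ?invf_le1 ?ler1n ?ltr0n.
Qed.

End Barycenter.

Section SingularSubdivision.
Variables (R : realType) (K : comNzRingType) (X : topologicalType).
Local Notation simplex := (singular_simplex R X).
Local Notation cochain := (cochain R K X).

Definition affine_face n (s : simplex n) m (g : 'I_m.+1 -> std_simplex R n) :
  simplex m := s \o hull g.

Lemma simplex_face_affine_face n (s : simplex n) l m (f : 'I_l.+1 -> 'I_m.+1)
    (g : 'I_m.+1 -> std_simplex R n) :
  simplex_face f (affine_face s g) = affine_face s (g \o f).
Proof. by apply/continuousEP => t; rewrite /= -hull_vertex_map. Qed.

Lemma affine_face_affine_face n (s : simplex n) l m
    (h : 'I_l.+1 -> std_simplex R m) (g : 'I_m.+1 -> std_simplex R n) :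
  affine_face (affine_face s g) h = affine_face s (hull g \o h).
Proof. by apply/continuousEP => t; rewrite /= -hull_hull. Qed.

Lemma affine_face_vertex n (s : simplex n) : affine_face s (vertex R) = s.
Proof. by apply/continuousEP => t; rewrite /= hull_vertex. Qed.

Lemma list_delta_affine n (s : simplex n) m (c : cochain m) w :
  size w = m.+2 ->
  list_delta (pull (affine_face s) c) w = pull (affine_face s) (coboundary c) w.
Proof.
by apply: list_delta_pull => l g i; exact: simplex_face_affine_face.
Qed.

Lemma pull_affine_face n (s : simplex n) l (g : 'I_l.+1 -> std_simplex R n)
    m (c : cochain m) w : size w = m.+1 ->
  pull (affine_face (affine_face s g)) c w =
  pull (affine_face s) c (map (hull g) w).
Proof.
case/vertex_list_surj=> h ->; rewrite -vertex_list_map !pull_vertex_list.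
by rewrite affine_face_affine_face.
Qed.

Lemma map_hull_vertex m n (g : 'I_m.+1 -> std_simplex R n) :
  map (hull g) (vertex_list (vertex R)) = vertex_list g.
Proof.
rewrite -vertex_list_map; congr vertex_list; apply/funext => i /=.
exact: hull_vertexE.
Qed.

Definition subdiv n (c : cochain n) : cochain n := fun s =>
  list_sd (@bary R n) n.+1 (pull (affine_face s) c) (vertex_list (vertex R)).

Definition subdiv_homotopy n (c : cochain n.+1) : cochain n := fun s =>
  list_hom (@bary R n) n.+1 (pull (affine_face s) c) (vertex_list (vertex R)).

(** Both operators are natural in the simplex, because affine maps preserve
    barycenters. *)
Lemma pull_subdiv n (s : simplex n) m (c : cochain m) w : size w = m.+1 ->
  pull (affine_face s) (subdiv c) w =
  list_sd (@bary R n) m.+1 (pull (affine_face s) c) w.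
Proof.
case/vertex_list_surj=> g ->; rewrite pull_vertex_list /subdiv.
rewrite -(map_hull_vertex g) -(list_sd_map (@hull_bary R _ _ g)); last first.
  exact: size_vertex_list.
apply: eq_list_sd => [|u su]; first exact: size_vertex_list.
exact: pull_affine_face.
Qed.

Lemma pull_subdiv_homotopy n (s : simplex n) m (c : cochain m.+1) w :
  size w = m.+1 ->
  pull (affine_face s) (subdiv_homotopy c) w =
  list_hom (@bary R n) m.+1 (pull (affine_face s) c) w.
Proof.
case/vertex_list_surj=> g ->; rewrite pull_vertex_list /subdiv_homotopy.
rewrite -(map_hull_vertex g) -(list_hom_map (@hull_bary R _ _ g)); last first.
  exact: size_vertex_list.
apply: eq_list_hom => [|u su]; first exact: size_vertex_list.
exact: pull_affine_face.
Qed.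

Lemma pull_iter_subdiv i n (s : simplex n) m (c : cochain m) w : size w = m.+1 ->
  pull (affine_face s) (iter i (@subdiv m) c) w =
  iter i (list_sd (@bary R n) m.+1) (pull (affine_face s) c) w.
Proof.
elim: i w => [//|i IH] w sw; rewrite !iterS pull_subdiv //.
exact: eq_list_sd.
Qed.

Lemma pull_vertices n (s : simplex n) (c : cochain n) :
  pull (affine_face s) c (vertex_list (vertex R)) = c s.
Proof. by rewrite pull_vertex_list affine_face_vertex. Qed.

Lemma subdiv_cocycle n (c : cochain n) :
  coboundary c = 0 -> coboundary (subdiv c) = 0.
Proof.
move=> c0; apply/funext => s; rewrite -[LHS]pull_vertices -list_delta_affine.
  have sv := size_vertex_list (@vertex R n.+1).
  rewrite (eq_list_delta (psi := list_sd (@bary R _) n.+1 (pull (affine_face s) c))).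
    rewrite -list_sd_delta // (eq_list_sd _ (psi := 0)) //.
      rewrite -(subrr (0 : seq (std_simplex R n.+1) -> K)) list_sdB !fctE.
      by rewrite subrr.
    by move=> u su; rewrite list_delta_affine // c0 pull0.
  by move=> u _; rewrite sv => -[su]; exact: pull_subdiv.
exact: size_vertex_list.
Qed.

Lemma coboundary_subdiv_homotopy n (c : cochain n.+1) :
  coboundary c = 0 -> coboundary (subdiv_homotopy c) = c - subdiv c.
Proof.
move=> c0; apply/funext => s; rewrite -[LHS]pull_vertices -list_delta_affine;
  last exact: size_vertex_list.
have sv := size_vertex_list (@vertex R n.+1).
rewrite -[RHS]/(c s - subdiv c s) -{1}(pull_vertices s c) -list_homotopy //.
rewrite [X in X + _](_ : _ = 0) ?add0r.
  apply: eq_list_delta => u _; rewrite sv => -[su].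
  exact: pull_subdiv_homotopy.
transitivity (list_hom (@bary R n.+1) n.+2
    (0 : seq (std_simplex R n.+1) -> K) (vertex_list (vertex R))).
  by apply: eq_list_hom => // u su; rewrite list_delta_affine // c0 pull0.
by rewrite -(subrr (0 : seq (std_simplex R n.+1) -> K)) list_homB !fctE subrr.
Qed.

End SingularSubdivision.

(** * Cochains vanishing on small simplices *)

Section SmallSimplices.
Variables (R : realType) (X : topologicalType).
Variable C : set (set X).
Hypothesis C_open : forall O, C O -> open O.
Hypothesis C_cover : forall x, exists2 O, C O & O x.
Local Open Scope classical_set_scope.

Definition small_simplex n (s : singular_simplex R X n) : Prop :=
  exists2 O, C O & forall t, O (s t).

Lemma std_simplex_compact n : compact (std_simplex R n).
Proof.
apply: bounded_closed_compact.
  exists 1; split; first exact: num_real.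
  move=> r r1 t [t0 t1]; apply: le_trans (ltW r1).
  rewrite [leLHS]mx_normrE; apply: bigmax_le => // -[i j] _ /=.
  rewrite (ord1 i) ger0_norm // -t1 (bigD1 j) //= lerDl.
  by rewrite sumr_ge0.
rewrite (_ : std_simplex R n = (\bigcap_i [set t : 'rV[R]_n.+1 | 0 <= t 0 i])
   `&` [set t | \sum_i t 0 i = 1]); last first.
  apply/seteqP; split=> t [t0 t1]; split=> // i; first by move=> _; exact: t0.
  exact: t0.
apply: closedI.
  apply: closed_bigI => i _.
  apply: (@preimage_closed _ _ (fun t : 'rV[R]_n.+1 => t 0 i) [set x | 0 <= x]).
    by move=> t _; exact: coord_continuous.
  exact: closed_ge.
apply: (@preimage_closed _ _ (fun t : 'rV[R]_n.+1 => \sum_i t 0 i) [set 1]).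
  by move=> t _; apply: continuous_real_sum => i; exact: coord_continuous.
exact: closed_eq.
Qed.

(** Compactness of the standard simplex makes the size of the neighbourhoods
    of its points that are mapped into a set of the cover uniform. *)
Lemma lebesgue_number n (s : singular_simplex R X n) :
  exists2 e : R, 0 < e & forall x : std_simplex R n, exists2 O, C O &
    forall y : std_simplex R n, `|val y - val x| < e -> O (s y).
Proof.
pose Q (e : R) (v : 'rV[R]_n.+1) := forall x : std_simplex R n, val x = v ->
  exists2 O, C O & forall y : std_simplex R n, `|val y - v| < e -> O (s y).
have /compact_near_coveringP near_cover := @std_simplex_compact n.
have FF : Filter (0^'+ : set_system R) by exact: at_right_proper_filter.
have : \forall e \near 0^'+, std_simplex R n `<=` Q e.
  apply: near_cover => v /mem_set vS.
  have [O CO Ov] := C_cover (s (exist _ v vS)).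
  have : nbhs (exist _ v vS : std_simplex R n) (s @^-1` O).
    by apply: (@cts_fun _ _ s); apply: open_nbhs_nbhs; split => //; exact: C_open.
  move=> [_ [[B oB <-] /= vB BO]].
  have [d /= d0 dB] : exists2 d : R, 0 < d & ball v d `<=` B.
    by apply/nbhs_ballP; exact: open_nbhs_nbhs.
  exists (ball v (d / 2), [set e | e < d / 2]) => /=.
    split; first by apply: nbhsx_ballx; rewrite divr_gt0.
    by apply: nbhs_right_lt; rewrite divr_gt0.
  move=> [v' e] /= [vv' ed] x xv'; exists O => // y yv'.
  apply: BO; apply: dB; move: vv'; rewrite -!ball_normE /= => vv'.
  rewrite -[v](subrK v') -addrA (le_lt_trans (ler_normD _ _)) //.
  rewrite [ltRHS](splitr d) ltrD // distrC; exact: lt_trans ed.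
case=> e /= e0 eP; exists (e / 2); first by rewrite divr_gt0.
move=> x; have /set_mem xS := valP x; apply: (eP (e / 2) _ _ _ xS x erefl) => /=.
  by rewrite sub0r normrN gtr0_norm ?divr_gt0 // ltr_pdivrMr // ltr_pMr // ltr1n.
by rewrite divr_gt0.
Qed.

Lemma close_points_std_simplex n (w : seq (std_simplex R n)) : close_points 1 w.
Proof.
move=> x y _ _; rewrite [leLHS]mx_normrE; apply: bigmax_le => // -[i j] _ /=.
rewrite (ord1 i) !mxE.
have le1 (t : std_simplex R n) : val t 0 j <= 1.
  rewrite -(std_simplex_sum1 t) (bigD1 j) //= lerDl.
  by rewrite sumr_ge0 // => k _; exact: std_simplex_ge0.
have := std_simplex_ge0 x j; have := std_simplex_ge0 y j.
by have := le1 x; have := le1 y; rewrite ler_norml; lra.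
Qed.

(** One bound serves for all affine simplices of [s], whatever their position:
    the sum of the homotopies in [small_cocycle_coboundary] involves, beside
    the subdivisions of [s], those of simplices of one dimension more. *)
Lemma subdiv_small_eq0 (K : comNzRingType) n m (s : singular_simplex R X n)
    (c : cochain R K X m) :
  (forall s', small_simplex s' -> c s' = 0) ->
  exists N, forall i w, (N <= i)%N -> size w = m.+1 ->
    pull (affine_face s) (iter i (@subdiv R K X m) c) w = 0.
Proof.
move=> c0; have [e e0 eP] := lebesgue_number s.
pose k : R := 1 - m.+1%:R^-1.
have k0 : 0 <= k by rewrite subr_ge0 invf_le1 ?ler1n ?ltr0n.
have k1 : `|k| < 1 by rewrite ger0_norm // gtrBl invr_gt0.
have := @cvg_expr R k k1 => /cvgr0Pnorm_lt /(_ e e0)[N _ NP].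
exists N => i w Ni sw; rewrite pull_iter_subdiv //.
apply: (@iter_list_sd_close _ _ _ _ _ (k ^+ i)) ler01 sw _ _ => //; last 2 first.
- exact: close_points_std_simplex.
- by rewrite mulr1.
move=> u /vertex_list_surj[g ->] cg; rewrite pull_vertex_list; apply: c0.
have mem_g j : g j \in vertex_list g by apply: map_f; rewrite mem_enum.
have [O CO gO] := eP (g ord0); exists O => // t; apply: gO => /=.
have := NP i Ni; rewrite /= ger0_norm ?exprn_ge0 // => /(le_lt_trans _); apply.
by apply: aff_dist => j; apply: cg.
Qed.

(** The homotopies of the successive subdivisions of [c] add up to a
    primitive of [c]: the sum is finite on each simplex, because iterated
    subdivision makes the pieces of the simplex small. *)
Theorem small_cocycle_coboundary (K : comNzRingType) n (c : cochain R K X n.+1) :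
  coboundary c = 0 -> (forall s, small_simplex s -> c s = 0) ->
  exists b, c = coboundary b.
Proof.
move=> dc0 c0; pose c_ i := iter i (@subdiv R K X n.+1) c.
have dc_ i : coboundary (c_ i) = 0.
  by elim: i => [//|i IH]; rewrite /c_ iterS subdiv_cocycle.
have homotopy_eq0 (s : singular_simplex R X n) : exists N, forall i, (N <= i)%N ->
    subdiv_homotopy (c_ i) s = 0.
  have [N NP] := subdiv_small_eq0 s c0; exists N => i Ni.
  rewrite -pull_vertices pull_subdiv_homotopy ?size_vertex_list //.
  rewrite (eq_list_hom _ (psi := 0)) ?size_vertex_list //; last first.
    by move=> u su; rewrite NP.
  by rewrite -(subrr (0 : seq (std_simplex R n) -> K)) list_homB !fctE subrr.
have [N NP] := choice homotopy_eq0.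
pose b : cochain R K X n := fun s => \sum_(0 <= i < N s) subdiv_homotopy (c_ i) s.
have bE s M : (N s <= M)%N -> b s = \sum_(0 <= i < M) subdiv_homotopy (c_ i) s.
  move=> NM; rewrite (big_cat_nat _ NM) //= [X in _ = _ + X]big_nat_cond.
  rewrite [X in _ = _ + X]big1 ?addr0 //.
  by move=> i /andP[/andP[Ni _] _]; exact: NP.
exists b; apply/funext => s.
have [N' N'P] := subdiv_small_eq0 s c0.
(* A number of terms that serves for [s] and for all its faces. *)
pose M := maxn N' (\max_(j < n.+2) N (simplex_face (lift j) s)).
have cM : c_ M s = 0.
  by rewrite -pull_vertices N'P ?size_vertex_list // leq_maxl.
transitivity (\sum_(0 <= i < M) coboundary (subdiv_homotopy (c_ i)) s).
  rewrite (telescope_sumr_eq (fun i => - c_ i s)) // ?cM ?oppr0 ?sub0r ?opprK //.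
  by move=> i _; rewrite coboundary_subdiv_homotopy // opprK addrC.
rewrite exchange_big; apply: eq_bigr => j _; rewrite -mulr_sumr -bE //.
apply: leq_trans (leq_maxr _ _).
exact: (@leq_bigmax _ (fun k : 'I_n.+2 => N (simplex_face (lift k) s)) j).
Qed.

End SmallSimplices.

(** * Homotopies and contractible subsets *)

Section PrismNaturality.
Variables (P P' Q Q' : eqType) (V : comPzRingType).
Variables (bot top : P -> Q) (bot' top' : P' -> Q') (f : P -> P') (F : Q -> Q').
Hypothesis F_bot : forall x, F (bot x) = bot' (f x).
Hypothesis F_top : forall x, F (top x) = top' (f x).

Lemma eq_list_prism (phi psi : seq Q -> V) w :
  (forall u, size u = (size w).+1 -> phi u = psi u) ->
  list_prism bot top phi w = list_prism bot top psi w.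
Proof.
elim: w phi psi => [//|x w IH] phi psi e /=; rewrite e /= ?size_map //.
by congr (_ - _); apply: IH => u su; apply: e; rewrite /= su.
Qed.

Lemma list_prism_map (phi : seq Q' -> V) w :
  list_prism bot top (phi \o map F) w = list_prism bot' top' phi (map f w).
Proof.
elim: w phi => [//|x w IH] phi /=; rewrite F_bot F_top.
congr (phi (_ :: _ :: _) - _).
  by rewrite -!map_comp; apply: eq_map => y /=.
by rewrite -IH -F_bot.
Qed.

End PrismNaturality.

Lemma continuous_pair (X Y Z : topologicalType) (f : X -> Y) (g : X -> Z) :
  continuous f -> continuous g -> continuous (fun x => (f x, g x)).
Proof. by move=> cf cg x; exact: cvg_pair (cf x) (cg x). Qed.

Section Homotopy.
Variables (R : realType) (K : comNzRingType) (X Y : topologicalType).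
Variable H : continuousType (Y * R)%type X.

Lemma at_time_continuous (a : R) : continuous (fun y => H (y, a)).
Proof.
move=> y; apply: (@continuous_comp _ _ _ (fun y => (y, a)) H); last exact: cts_fun.
by apply: continuous_pair; [move=> z | exact: cst_continuous].
Qed.

Definition at_time (a : R) : continuousType Y X := mkcts (@at_time_continuous a).

Section PrismSimplex.
Variables (n : nat) (s : singular_simplex R Y n).

Lemma prism_simplex_continuous m (g : 'I_m.+1 -> std_simplex R n * R) :
  continuous (fun t : std_simplex R m =>
    H (s (hull (fst \o g) t), aff (snd \o g : 'I_m.+1 -> R^o) t)).
Proof.
move=> t; apply: (@continuous_comp _ _ _ (fun t => (_, _)) H); last exact: cts_fun.
apply: continuous_pair; last exact: aff_continuous.
exact: (@cts_fun _ _ (s \o hull (fst \o g))).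
Qed.

(** The simplices of [X] that come from the affine simplices of the prism
    over [s], with vertices in the standard simplex times the real line. *)
Definition prism_simplex m (g : 'I_m.+1 -> std_simplex R n * R) :
  singular_simplex R X m := mkcts (@prism_simplex_continuous m g).

Lemma simplex_face_prism m (g : 'I_m.+2 -> std_simplex R n * R) (i : 'I_m.+2) :
  simplex_face (lift i) (prism_simplex g) = prism_simplex (g \o lift i).
Proof.
apply/continuousEP => t /=; rewrite /mkcts; congr (H (s _, _)).
  by rewrite -[LHS]/((hull _ \o vertex_map _ _) t) hull_vertex_map.
exact: aff_vertex_map.
Qed.

Lemma list_delta_prism m (c : cochain R K X m) w : size w = m.+2 ->
  list_delta (pull prism_simplex c) w = pull prism_simplex (coboundary c) w.
Proof. by apply: list_delta_pull => l g i; exact: simplex_face_prism. Qed.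

Lemma prism_simplex_time a m (g : 'I_m.+1 -> std_simplex R n) :
  prism_simplex (fun i => (g i, a)) = at_time a \o affine_face s g.
Proof.
apply/continuousEP => t /=; rewrite /mkcts; congr (H (s _, _)).
exact: (@aff_cst _ R^o _ a).
Qed.

End PrismSimplex.

Lemma prism_affine_face n (s : singular_simplex R Y n) l
    (h : 'I_l.+1 -> std_simplex R n) m (g : 'I_m.+1 -> std_simplex R l * R) :
  prism_simplex (affine_face s h) g =
  prism_simplex s (fun i => (hull h (g i).1, (g i).2)).
Proof.
apply/continuousEP => t /=; rewrite /mkcts; congr (H (s _, _)).
by rewrite -[LHS]/((hull h \o hull _) t) hull_hull.
Qed.

Variables a b : R.

Definition prism_cochain n (c : cochain R K X n.+1) : cochain R K Y n := fun s =>
  list_prism (fun x => (x, a)) (fun x => (x, b)) (pull (prism_simplex s) c)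
    (vertex_list (vertex R)).

Lemma pull_prism_cochain n (s : singular_simplex R Y n) m
    (c : cochain R K X m.+1) w : size w = m.+1 ->
  pull (affine_face s) (prism_cochain c) w =
  list_prism (fun x => (x, a)) (fun x => (x, b)) (pull (prism_simplex s) c) w.
Proof.
case/vertex_list_surj=> g ->; rewrite pull_vertex_list /prism_cochain.
rewrite -(map_hull_vertex g).
transitivity (list_prism (fun x => (x, a)) (fun x => (x, b))
    (pull (prism_simplex s) c \o map (fun x => (hull g x.1, x.2)))
    (vertex_list (vertex R))); last exact: list_prism_map.
apply: eq_list_prism => u; rewrite size_vertex_list => /vertex_list_surj[h ->].
by rewrite /= -vertex_list_map !pull_vertex_list prism_affine_face.
Qed.

Lemma homotopy_coboundary n (c : cochain R K X n.+1) :
  coboundary c = 0 -> forall s,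
  coboundary (prism_cochain c) s = c (at_time b \o s) - c (at_time a \o s).
Proof.
move=> c0 s; rewrite -[LHS]pull_vertices -list_delta_affine;
  last exact: size_vertex_list.
have sv := size_vertex_list (@vertex R n.+1).
rewrite (eq_list_delta (psi := list_prism (fun x => (x, a)) (fun x => (x, b))
   (pull (prism_simplex s) c))); last first.
  by move=> u _; rewrite sv => -[su]; exact: pull_prism_cochain.
set phi := pull (prism_simplex s) c.
have prism0 : list_prism (fun x => (x, a)) (fun x => (x, b)) (list_delta phi)
    (vertex_list (vertex R)) = 0.
  transitivity (list_prism (fun x => (x, a)) (fun x => (x, b))
     (0 : seq (std_simplex R n.+1 * R) -> K) (vertex_list (vertex R))).
    apply: eq_list_prism => u; rewrite sv => su.
    by rewrite list_delta_prism // c0 pull0.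
  by rewrite -(subrr (0 : seq (std_simplex R n.+1 * R) -> K)) list_prismB !fctE subrr.
have /= := list_prism_homotopy (fun x => (x, a)) (fun x => (x, b)) phi
   (vertex_list (vertex R)).
rewrite prism0 add0r => ->; rewrite -!vertex_list_map /phi.
rewrite (pull_vertex_list (prism_simplex s) c (fun i => (vertex R i, b))).
rewrite (pull_vertex_list (prism_simplex s) c (fun i => (vertex R i, a))).
by rewrite !prism_simplex_time !affine_face_vertex.
Qed.

End Homotopy.

Section ContractibleSubset.
Variables (R : realType) (K : comNzRingType) (X : topologicalType).
Local Open Scope classical_set_scope.

Lemma sum_sign n (v : K) : \sum_(i < n) (-1) ^+ i * v = if odd n then v else 0.
Proof.
elim: n => [|n IH]; first by rewrite big_ord0.
rewrite big_ord_recr /= IH -signr_odd.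
by case: (odd n); rewrite /= ?expr0 ?expr1 ?mul1r ?mulN1r ?subrr ?add0r.
Qed.

(** A point has no cohomology in positive degree. *)
Lemma cocycle_cst n (c : cochain R K X n.+1) (x : X) : coboundary c = 0 ->
  exists v : K, forall s : singular_simplex R X n.+1, (forall t, s t = x) ->
    c s = coboundary ((fun=> v) : cochain R K X n) s.
Proof.
move=> c0; pose cs m : singular_simplex R X m := cst x.
exists (c (cs n.+1)) => s sx; rewrite /coboundary sum_sign /= negbK.
have -> : s = cs n.+1 by apply/continuousEP.
case: ifP => // n_even.
have : coboundary c (cs n.+2) = 0 by rewrite c0.
rewrite /coboundary (eq_bigr (fun i : 'I_n.+3 => (-1) ^+ i * c (cs n.+1))).
  by rewrite sum_sign /= negbK n_even.
by move=> i _; congr (_ * c _); apply/continuousEP.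
Qed.

(** The contraction takes place in [X]: it may leave [U]. *)
Definition contractible_in (U : set X) : Prop :=
  exists (H : continuousType (set_type U * R)%type X) (x : X),
    (forall u, H (u, 0) = val u) /\ (forall u, H (u, 1) = x).

Section Corestriction.
Variables (U : set X) (n : nat) (s : singular_simplex R X n).
Hypothesis sU : forall t, U (s t).

Definition corestrict_fun t : set_type U := exist _ (s t) (mem_set (sU t)).

Lemma corestrict_continuous : continuous corestrict_fun.
Proof.
apply: (@continuous_comp_initial (set_type U) _ _ set_val).
exact: (@cts_fun _ _ s).
Qed.

Definition corestrict : singular_simplex R (set_type U) n :=
  mkcts corestrict_continuous.

End Corestriction.

(** Extension by zero; it commutes with coboundaries on the simplices of [U],
    because their faces are in [U] again. *)
Definition extend_cochain (U : set X) n (c : cochain R K (set_type U) n) :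
    cochain R K X n := fun s =>
  if pselect (forall t, U (s t)) is left sU then c (corestrict sU) else 0.

Lemma extend_cochainE (U : set X) n (c : cochain R K (set_type U) n)
    (s : singular_simplex R X n)
    (sU : forall t, U (s t)) : extend_cochain c s = c (corestrict sU).
Proof.
rewrite /extend_cochain; case: pselect => // sU'.
by congr c; apply/continuousEP => t; apply/val_inj.
Qed.

Lemma coboundary_extend (U : set X) n (c : cochain R K (set_type U) n)
    (s : singular_simplex R X n.+1)
    (sU : forall t, U (s t)) :
  coboundary (extend_cochain c) s = coboundary c (corestrict sU).
Proof.
apply: eq_bigr => i _; rewrite extend_cochainE => [t|fU]; first exact: sU.
by congr (_ * c _); apply/continuousEP => t; apply/val_inj.
Qed.

(** On [U], the inclusion is homotopic to a constant map, which factors through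
    a point. *)
Lemma contractible_in_coboundary (U : set X) n (c : cochain R K X n.+1) :
  contractible_in U -> coboundary c = 0 ->
  exists b : cochain R K X n,
    forall s : singular_simplex R X n.+1, (forall t, U (s t)) ->
      c s = coboundary b s.
Proof.
move=> [H [x [H0 H1]]] c0; have [v vP] := cocycle_cst x c0.
pose d := prism_cochain H 0 1 c.
exists (extend_cochain (((fun=> v) : cochain R K _ n) - d)) => s sU.
rewrite (coboundary_extend _ sU) raddfB /= cochainBE /d homotopy_coboundary //.
have -> : at_time H 0 \o corestrict sU = s :> singular_simplex R X n.+1.
  by apply/continuousEP => t; rewrite /= /mkcts H0.
rewrite (vP (at_time H 1 \o corestrict sU)); last first.
  by move=> t; rewrite /= /mkcts H1.
by rewrite /coboundary opprB addrC subrK.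
Qed.

Lemma coboundary_coboundary n (c : cochain R K X n) :
  coboundary (coboundary c) = 0.
Proof.
apply/funext => s; have sv := size_vertex_list (@vertex R n.+2).
rewrite -[LHS]pull_vertices -list_delta_affine // cochain0E.
rewrite -(list_delta_delta (pull (affine_face s) c) (vertex_list (vertex R))).
apply: eq_list_delta => u _; rewrite sv => -[su].
by rewrite list_delta_affine.
Qed.

(** * Cup products on a union of two contractible open subsets *)

(** The restriction of the class to [U] is zero; extending a primitive and
    subtracting its coboundary clears the cocycle on [U]. *)
Lemma cohomology_rep (U : set X) n (x : cohomology R K X n.+1) :
  contractible_in U -> exists a : cocycle R K X n.+1,
    x = (\pi_(cohomology R K X n.+1) a)%qT /\
    forall s : singular_simplex R X n.+1, (forall t, U (s t)) ->
      cocycle_val a s = 0.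
Proof.
move=> /contractible_in_coboundary cU.
have /cocycle_predP dx := cocycleP (repr x); have [b xb] := cU _ _ dx.
have zP : cocycle_val (repr x) - coboundary b \in @cocycle_pred R K X n.+1.
  by apply/cocycle_predP; rewrite raddfB /= dx coboundary_coboundary subrr.
exists (Cocycle zP); split=> [|s sU]; last by rewrite /= cochainBE xb ?subrr.
rewrite -[LHS]reprK; apply/eqP; rewrite -Quotient.idealrBE.
apply/coboundary_predP; exists b.
rewrite -[LHS]/(cocycle_val (repr x) - (cocycle_val (repr x) - _)).
by rewrite opprB addrC subrK.
Qed.

(** Front and back faces of a simplex of [U] or of [V] stay there, so one of
    the two factors of the product vanishes. *)
Theorem cup_two_contractible (U V : set X) :
  open U -> open V -> U `|` V = setT -> contractible_in U -> contractible_in V ->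
  forall p q (x : cohomology R K X p) (y : cohomology R K X q),
  (0 < p)%N -> (0 < q)%N -> cup x y = 0.
Proof.
move=> oU oV UV ctrU ctrV [//|p] [//|q] x y _ _.
have [a [-> aU]] := cohomology_rep x ctrU.
have [b [-> bV]] := cohomology_rep y ctrV.
rewrite cup_pi.
suff : is_coboundary (cocycle_val (cup_cocycle a b)).
  move=> ab.
  have <- : (\pi_(cohomology R K X (p.+1 + q.+1)) 0)%qT = 0.
    exact: pi_zeror.
  apply/eqP.
  rewrite -Quotient.idealrBE subr0; exact/coboundary_predP.
have [] // := @small_cocycle_coboundary R X [set U; V] _ _ K _
    (cocycle_val (cup_cocycle a b)).
- by move=> O [] ->.
- move=> z; have : (U `|` V) z by rewrite UV.
  by case=> ?; [exists U; [left|]|exists V; [right|]].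
- exact/cocycle_predP/cocycleP.
- move=> s [O [-> sO|-> sO]] /=; rewrite /cup_cochain /cup_at.
    by rewrite aU ?mul0r // => t; exact: sO.
  by rewrite bV ?mulr0 // => t; exact: sO.
by move=> d dP; exists d.
Qed.

End ContractibleSubset.

(** * The covering of a moment-angle complex *)

Section Disk.
Variable R : realType.
Implicit Types (p v : R * R) (a : R).

Definition norm2 v : R := v.1 ^+ 2 + v.2 ^+ 2.

Definition segment p v a : R * R :=
  ((1 - a) * p.1 + a * v.1, (1 - a) * p.2 + a * v.2).

(** Radial stretching by the factor [2], stopped at the unit circle; it fixes
    the circle and maps all [v] with [4^-1 <= norm2 v] to it. *)
Definition stretch v : R * R :=
  let k := 2 / Num.max 1 (2 * Num.sqrt (norm2 v)) in (k * v.1, k * v.2).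

Definition base_point : R * R := (1, 0).

Lemma norm2_ge0 v : 0 <= norm2 v.
Proof. by rewrite addr_ge0 // sqr_ge0. Qed.

Lemma segment0 p v : segment p v 0 = p.
Proof. by case: p v => [p1 p2] [v1 v2]; rewrite /segment /=; congr (_, _); ring. Qed.

Lemma segment1 p v : segment p v 1 = v.
Proof. by case: p v => [p1 p2] [v1 v2]; rewrite /segment /=; congr (_, _); ring. Qed.

Lemma segmentxx v a : segment v v a = v.
Proof. by case: v => [v1 v2]; rewrite /segment /=; congr (_, _); ring. Qed.

(** The squared norm is convex: its defect from linearity on the segment is
    [- a * (1 - a)] times the squared distance of the endpoints. *)
Lemma norm2_segment p v a : 0 <= a <= 1 -> norm2 p <= 1 -> norm2 v <= 1 ->
  norm2 (segment p v a) <= 1.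
Proof.
case: p v => [p1 p2] [v1 v2]; rewrite /norm2 /segment /= => /andP[a0 a1] p1' v1'.
have -> : ((1 - a) * p1 + a * v1) ^+ 2 + ((1 - a) * p2 + a * v2) ^+ 2 =
    (1 - a) * (p1 ^+ 2 + p2 ^+ 2) + a * (v1 ^+ 2 + v2 ^+ 2)
    - a * (1 - a) * ((p1 - v1) ^+ 2 + (p2 - v2) ^+ 2) by ring.
have h1 : 0 <= a * (1 - a) * ((p1 - v1) ^+ 2 + (p2 - v2) ^+ 2).
  by rewrite mulr_ge0 ?addr_ge0 ?sqr_ge0 // mulr_ge0 // subr_ge0.
have h2 : (1 - a) * (p1 ^+ 2 + p2 ^+ 2) <= (1 - a) * 1.
  by rewrite ler_wpM2l // subr_ge0.
have h3 : a * (v1 ^+ 2 + v2 ^+ 2) <= a * 1 by rewrite ler_wpM2l.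
lra.
Qed.

Lemma norm2_stretch v : norm2 (stretch v) =
  (2 * Num.sqrt (norm2 v) / Num.max 1 (2 * Num.sqrt (norm2 v))) ^+ 2.
Proof.
set m := Num.max _ _.
have -> : norm2 (stretch v) = (2 / m) ^+ 2 * norm2 v.
  by rewrite /stretch -/m /norm2 /=; ring.
rewrite -[in LHS](sqr_sqrtr (norm2_ge0 v)); ring.
Qed.

Lemma norm2_stretch_le1 v : norm2 (stretch v) <= 1.
Proof.
rewrite norm2_stretch; set x := 2 * _.
have x0 : 0 <= x by rewrite mulr_ge0 ?sqrtr_ge0.
have m0 : 0 < Num.max 1 x by rewrite lt_max ltr01.
apply: exprn_ile1; first by rewrite divr_ge0 // ltW.
by rewrite ler_pdivrMr // mul1r le_max lexx orbT.
Qed.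

Lemma norm2_stretch_eq1 v : 4^-1 <= norm2 v -> norm2 (stretch v) = 1.
Proof.
move=> v4; rewrite norm2_stretch; set x := 2 * _.
have : Num.sqrt (2^-1 ^+ 2) <= Num.sqrt (norm2 v).
  by rewrite ler_sqrt ?norm2_ge0 // (le_trans _ v4) // exprVn -natrX.
rewrite sqrtr_sqr ger0_norm ?invr_ge0 // => half_le.
have x1 : 1 <= x by rewrite /x; lra.
by rewrite max_r // divff ?expr1n //; lra.
Qed.

Lemma stretch_id v : norm2 v = 1 -> stretch v = v.
Proof.
move=> v1; rewrite /stretch v1 sqrtr1 mulr1 max_r ?ler1n // divff ?pnatr_eq0 //.
by case: v {v1} => x y /=; rewrite !mul1r.
Qed.

Lemma fst_continuous (X Y : topologicalType) : continuous (@fst X Y).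
Proof. by move=> v; exact: cvg_fst. Qed.

Lemma snd_continuous (X Y : topologicalType) : continuous (@snd X Y).
Proof. by move=> v; exact: cvg_snd. Qed.

Lemma continuous_comp_fun (X Y Z : topologicalType) (f : X -> Y) (g : Y -> Z) :
  continuous f -> continuous g -> continuous (fun x => g (f x)).
Proof.
by move=> cf cg x; apply: (@continuous_comp _ _ _ f g); [exact: cf | exact: cg].
Qed.

Lemma norm2_continuous : continuous norm2.
Proof.
apply: continuous_addr; apply: continuous_mulr;
  by [exact: fst_continuous | exact: snd_continuous].
Qed.

Lemma stretch_continuous : continuous stretch.
Proof.
have k_cont : continuous
    (fun v => 2 / Num.max 1 (2 * Num.sqrt (norm2 v)) : R).
  apply: continuous_mulr; first exact: cst_continuous.
  move=> v; apply: cvgV; first by rewrite gt_eqF // lt_max ltr01.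
  apply: (@continuous_max _ _ (cst 1) (fun v => 2 * Num.sqrt (norm2 v))).
    exact: cst_continuous.
  move: v; apply: continuous_mulr; first exact: cst_continuous.
  move=> v; apply: (@continuous_comp _ _ _ norm2 Num.sqrt).
    exact: norm2_continuous.
  exact: sqrt_continuous.
by apply: continuous_pair; apply: continuous_mulr => //;
  [exact: fst_continuous | exact: snd_continuous].
Qed.

Lemma segment_continuous (X : topologicalType) (f g : X -> R * R) (c : X -> R) :
  continuous f -> continuous g -> continuous c ->
  continuous (fun x => segment (f x) (g x) (c x)).
Proof.
move=> cf cg cc.
have c1 : continuous (fun x => 1 - c x).
  apply: continuous_addr; first exact: cst_continuous.
  by move=> x; apply: cvgN; exact: cc.
by apply: continuous_pair; apply: continuous_addr; apply: continuous_mulr => //;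
  apply: continuous_comp_fun => //; [exact: fst_continuous | exact: fst_continuous
   | exact: snd_continuous | exact: snd_continuous].
Qed.

Definition clamp a : R := Num.max 0 (Num.min 1 a).

Lemma clamp_itv a : 0 <= clamp a <= 1.
Proof. by rewrite /clamp le_max lexx ge_max ler01 ge_min lexx. Qed.

Lemma clamp_eq0 a : a <= 0 -> clamp a = 0.
Proof. by move=> a0; rewrite /clamp min_r ?max_l // (le_trans a0) ?ler01. Qed.

Lemma clamp_eq1 a : 1 <= a -> clamp a = 1.
Proof. by move=> a0; rewrite /clamp min_l ?max_r ?ler01. Qed.

Lemma clamp_continuous (X : topologicalType) (f : X -> R) :
  continuous f -> continuous (fun x => clamp (f x)).
Proof.
move=> cf x; apply: (@continuous_max _ _ (cst 0) (fun x => Num.min 1 (f x))).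
  exact: cst_continuous.
apply: (@continuous_min _ _ (cst 1) f); last exact: cf.
exact: cst_continuous.
Qed.

End Disk.

Section MomentAngleContraction.
Variables (R : realType) (T : finType) (W : {set T}) (D : {set {set T}}).
Variables (A : {set T}) (DA : {set {set T}}).
Hypothesis D_down : forall F G : {set T}, F \in D -> G \subset F -> G \in D.
Hypothesis DA_down : forall F G : {set T}, F \in DA -> G \subset F -> G \in DA.
Hypothesis D_of_DA : forall F : {set T},
  F \subset W -> finset.setI F A \in DA -> F \in D.
Hypothesis D_of_subset : forall F : {set T}, F \subset W -> F \subset A -> F \in D.
Local Notation I := {x : T | x \in W}.
Local Notation X := (moment_angle_complex R W D).

Definition off_circle (v : I -> R * R) : {set T} :=
  [set val i | i : I & v i \notin @unit_circle R]%SET.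

(** [A] stands for either of the two ground sets and [DA] for the complex on
    it. The inequality is weak so that nearby points have smaller cores, whence
    [open_core_nbhs]. *)
Definition core (v : I -> R * R) : {set T} :=
  [set val i | i : I & (val i \in A) && (norm2 (v i) <= 4^-1)]%SET.

Lemma off_circle_sub v (F : {set T}) :
  (forall i : I, norm2 (v i) <> 1 -> val i \in F) -> off_circle v \subset F.
Proof.
move=> vF; apply/fintype.subsetP => _ /imsetP[i vi ->]; apply: vF => vi1.
by move: vi; rewrite inE => /negP; apply; exact/mem_set.
Qed.

Lemma mem_off_circle v (i : I) : norm2 (v i) <> 1 -> val i \in off_circle v.
Proof.
move=> vi; apply/imsetP; exists i => //.
by rewrite inE; apply/negP => /set_mem.
Qed.

Lemma off_circleW v : off_circle v \subset W.
Proof. by apply: off_circle_sub => i _; exact: valP. Qed.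

Definition core_nbhs : set X := [set u | core (val u) \in DA]%classic.

Lemma coord_continuous_mac (i : I) : continuous (fun u : X => val u i).
Proof.
move=> u; apply: (@continuous_comp _ _ _ set_val
  (fun v : {ptws I -> (R * R)%type} => v i)).
  exact: initial_continuous.
exact: (@proj_continuous I (fun=> (R * R)%type) i).
Qed.

Lemma norm2_coord_continuous (i : I) : continuous (fun u : X => norm2 (val u i)).
Proof.
move=> u; apply: (@continuous_comp _ _ _ (fun u : X => val u i) (@norm2 R)).
  exact: coord_continuous_mac.
exact: norm2_continuous.
Qed.

Lemma open_core_nbhs : open core_nbhs.
Proof.
rewrite openE => u /= uDA; have FF : Filter (nbhs u) by exact: nbhs_filter.
have near_i (i : I) : \forall u' \near u,
    norm2 (val u' i) <= 4^-1 -> norm2 (val u i) <= 4^-1.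
  have [ui|ui] := leP (norm2 (val u i)) 4^-1; first exact: filterE.
  have : \forall u' \near u, 4^-1 < norm2 (val u' i).
    by have /cvgr_gt/(_ _ ui) := @norm2_coord_continuous i u; exact.
  by apply: filterS => u' u'i; rewrite leNgt u'i.
have := filter_forall FF near_i; apply: filterS => u' le_u.
apply: (DA_down uDA); apply/fintype.subsetP => _ /imsetP[i + ->].
rewrite inE => /andP[iA ui]; apply/imsetP; exists i => //.
by rewrite inE iA le_u.
Qed.

(** The three stages last one unit of the time [3 * y.2] each. The coordinates
    in [A] are stretched, which brings the point to the piece where the other
    coordinates are free; the latter are moved to the base point of the circle,
    which sets the coordinates in [A] free; finally these are moved too. *)
Definition contraction_fun (y : set_type core_nbhs * R) : {ptws I -> (R * R)%type} :=
  fun i => let p := val (val y.1) i in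
  if val i \in A then
    segment (segment p (stretch p) (clamp (3 * y.2))) (base_point R)
      (clamp (3 * y.2 - 2))
  else segment p (base_point R) (clamp (3 * y.2 - 1)).

Lemma contraction_subproof y :
  contraction_fun y \in moment_angle_set R W D.
Proof.
case: y => u a; have /set_mem[disk_u supp_u] := valP (val u).
have core_u : core (val (val u)) \in DA by have /set_mem := valP u.
have base1 : norm2 (base_point R) = 1 by rewrite /norm2 /=; ring.
apply/mem_set; split=> [i|].
  rewrite /unit_disk /= -/(norm2 _) /contraction_fun.
  case: ifP => _ /=; rewrite norm2_segment ?clamp_itv ?base1 //; last exact: disk_u.
  by rewrite norm2_segment ?clamp_itv ?norm2_stretch_le1 //; exact: disk_u.
rewrite -/(off_circle _); set v := contraction_fun _.
have [a1|a1] := leP (3 * a) 1.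
  (* First stage: stretching keeps every point of the circle in place. *)
  apply: D_down supp_u _; rewrite -/(off_circle _).
  apply: off_circle_sub => i vi; apply: mem_off_circle => ui; apply: vi.
  rewrite /v /contraction_fun /= (stretch_id ui) segmentxx.
  by rewrite !(clamp_eq0 (_ : _ <= 0)) ?segment0 ?if_same //; lra.
have [a2|a2] := leP (3 * a) 2.
  (* Second stage: in A, only points of the core are off the circle. *)
  apply: D_of_DA (off_circleW v) _; apply: DA_down core_u _.
  apply/fintype.subsetP => _ /finset.setIP[/imsetP[i vi ->] iA].
  apply/imsetP; exists i => //; rewrite inE iA /=; move: vi.
  rewrite inE; apply: contraNT; rewrite -ltNge => /ltW ui; apply/mem_set.
  rewrite /unit_circle /= -/(norm2 _) /v /contraction_fun /= iA.
  rewrite (clamp_eq1 (ltW a1)) segment1 clamp_eq0 ?segment0; last by lra.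
  exact: norm2_stretch_eq1.
(* Third stage: outside A, all coordinates are at the base point. *)
apply: D_of_subset (off_circleW v) _; apply: off_circle_sub => i vi.
apply: contra_notT vi => /negPf iA.
by rewrite /v /contraction_fun iA /= clamp_eq1 ?segment1 //; lra.
Qed.

Definition contraction (y : set_type core_nbhs * R) : X :=
  exist (fun v => v \in moment_angle_set R W D) _ (contraction_subproof y).

Lemma contraction_continuous : continuous contraction.
Proof.
apply: (@continuous_comp_initial X _ _ set_val) => y.
apply/cvg_sup => i; move: y; apply: (@continuous_comp_initial _ _ _ (@^~ i)).
have time_cont (b : R) :
    continuous (fun y : set_type core_nbhs * R => clamp (3 * y.2 - b)).
  apply: clamp_continuous; apply: continuous_addr; last exact: cst_continuous.
  apply: continuous_mulr; first exact: cst_continuous.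
  exact: snd_continuous.
have coord_cont :
    continuous (fun y : set_type core_nbhs * R => val (val y.1) i).
  apply: (@continuous_comp_fun _ X _ (fun y => set_val y.1)
    (fun u : X => val u i)).
    apply: (@continuous_comp_fun _ _ _ fst set_val); first exact: fst_continuous.
    exact: initial_continuous.
  exact: coord_continuous_mac.
have base_cont : continuous (fun y : set_type core_nbhs * R => base_point R).
  exact: cst_continuous.
have stretch_cont :
    continuous (fun y : set_type core_nbhs * R => stretch (val (val y.1) i)).
  apply: (@continuous_comp_fun _ _ _ _ (@stretch R)); first exact: coord_cont.
  exact: stretch_continuous.
rewrite -[X in continuous X]/(fun y => contraction_fun y i) /contraction_fun.
case: (val i \in A); last by apply: segment_continuous.
apply: segment_continuous => //; apply: segment_continuous => //.
by have := time_cont 0; under eq_fun do rewrite subr0.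
Qed.

Lemma core_nbhs_contractible : contractible_in R core_nbhs.
Proof.
pose x : {ptws I -> (R * R)%type} := fun=> base_point R.
have xP : x \in moment_angle_set R W D.
  apply/mem_set; split=> [i|]; first by rewrite /unit_disk /= expr1n expr0n addr0.
  apply: D_of_subset; first exact: off_circleW.
  apply: off_circle_sub => i; case.
  by rewrite /norm2 /= expr1n expr0n addr0.
exists (mkcts contraction_continuous), (exist _ x xP); split=> u.
  apply/val_inj/funext => i; rewrite /= /contraction_fun /=.
  by rewrite !(clamp_eq0 (_ : _ <= 0)) ?segment0 ?if_same //; lra.
apply/val_inj/funext => i; rewrite /= /contraction_fun /=.
by rewrite !(clamp_eq1 (_ : 1 <= _)) ?segment1 ?if_same //; lra.
Qed.

End MomentAngleContraction.

(** * The dual of the join of two duals *)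

Section DualJoin.
Variable T : finType.
Local Open Scope set_scope.
Implicit Types (W F : {set T}) (D : {set {set T}}).

(** In the ground set [W], the set [F1] is the complement of [F]. *)
Lemma setI_of_setD W W' F F1 F2 : [disjoint W & W'] -> F2 \subset W' ->
  (W :|: W') :\: F = F1 :|: F2 -> finset.setI W F = W :\: F1.
Proof.
move=> WW' F2W' E; apply/setP => x; rewrite !inE.
have [xW|] := boolP (x \in W); last by rewrite andbF.
have xF2 : x \notin F2.
  by apply: contraFN (disjointFr WW' xW) => /(fintype.subsetP F2W').
have := congr1 (fun G : {set T} => x \in G) E.
by rewrite !inE xW (negPf xF2) orbF andbT andbT => <-; rewrite negbK.
Qed.

Lemma mem_dual_join_dual W1 W2 D1 D2 F : [disjoint W1 & W2] ->
  (F \in alexander_dual (W1 :|: W2)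
     (complex_join (alexander_dual W1 D1) (alexander_dual W2 D2))) =
  (F \subset W1 :|: W2) &&
  ((finset.setI W1 F \in D1) || (finset.setI W2 F \in D2)).
Proof.
move=> W12; rewrite inE; case: (boolP (F \subset _)) => //= FW.
rewrite -[RHS]negbK negb_or; congr negb.
apply/imset2P/andP => [[F1 F2]|[F1 F2]].
  rewrite !inE => /andP[F1W F1D] /andP[F2W F2D] E.
  rewrite (setI_of_setD W12 F2W E) F1D (@setI_of_setD W2 W1 F F2 F1) ?F2D //.
    by rewrite disjoint_sym.
  by rewrite finset.setUC E finset.setUC.
exists (W1 :\: F) (W2 :\: F); last exact: finset.setDUl.
  by rewrite inE finset.subsetDl finset.setDDr finset.setDv finset.set0U.
by rewrite inE finset.subsetDl finset.setDDr finset.setDv finset.set0U.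
Qed.

End DualJoin.

Theorem corollary1p3 (R : realType) (K : fieldType) (T : finType)
    (W1 W2 : {set T}) (D1 D2 : {set {set T}}) :
  [disjoint W1 & W2] ->
  simplicial_complex W1 D1 -> finset.set0 \in D1 ->
  simplicial_complex W2 D2 -> finset.set0 \in D2 ->
  let W := finset.setU W1 W2 in
  let D := alexander_dual W
             (complex_join (alexander_dual W1 D1) (alexander_dual W2 D2)) in
  forall (p q : nat)
    (x : cohomology R K (moment_angle_complex R W D) p)
    (y : cohomology R K (moment_angle_complex R W D) q),
  (0 < p)%N -> (0 < q)%N -> cup x y = 0.
Proof.
move=> W12 [_ D1_down] D1_0 [_ D2_down] D2_0 W D p q x y.
have DE (F : {set T}) : F \in D = (F \subset W) &&
    ((finset.setI W1 F \in D1) || (finset.setI W2 F \in D2)).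
  exact: mem_dual_join_dual.
have D_down (F G : {set T}) : F \in D -> G \subset F -> G \in D.
  rewrite !DE => /andP[FW FD] GF; rewrite (fintype.subset_trans GF FW) /=.
  by case/orP: FD => FD; apply/orP;
    [left; apply: D1_down FD _ | right; apply: D2_down FD _]; exact: finset.setIS.
have disj1 (F : {set T}) : F \subset W1 -> finset.setI W2 F = finset.set0.
  move=> FW; apply/eqP; rewrite finset.setIC setI_eq0.
  exact: disjointWl FW W12.
have disj2 (F : {set T}) : F \subset W2 -> finset.setI W1 F = finset.set0.
  by move=> FW; apply/eqP; rewrite setI_eq0; exact: disjointWr FW W12.
apply: (@cup_two_contractible R K _
  (@core_nbhs R T W D W1 D1) (@core_nbhs R T W D W2 D2)).
- exact: open_core_nbhs.
- exact: open_core_nbhs.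
- apply/seteqP; split=> // u _.
  have /set_mem[_] := valP u; rewrite -/(off_circle _) DE => /andP[_ uD].
  have core_off (A : {set T}) :
      core A (val u) \subset finset.setI A (off_circle (val u)).
    apply/fintype.subsetP => _ /imsetP[i + ->]; rewrite !inE => /andP[iA ui].
    rewrite iA /=; apply: mem_off_circle => u1; move: ui.
    by rewrite u1 => ?; lra.
  by case/orP: uD => uD; [left; apply: D1_down uD _ | right; apply: D2_down uD _];
    exact: core_off.
- apply: core_nbhs_contractible => // F FW FD; rewrite DE FW /=.
    by rewrite finset.setIC FD.
  by rewrite disj1 // D2_0 orbT.
- apply: core_nbhs_contractible => // F FW FD; rewrite DE FW /=.
    by rewrite (finset.setIC W2) FD orbT.
  by rewrite disj2 // D1_0.
Qed.
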